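(* Let $P$ be a UMEL-shellable poset, with $\lambda$ an EL-labeling such that $(P,\lambda)$ is a monotonic rank-uniform labeled poset, and let $a$ be an atom of $P$. Then: (i) $\gamma(\underline{\mathrm H}_P;y)\preceq\gamma(\mathrm H_P;y)$; (ii) $\gamma(\mathrm H_{[a,\hat 1]};y)\preceq\gamma(\underline{\mathrm H}_P;y)$; (iii) $\gamma(\mathrm H_{[a,\hat 1]};y)\preceq\gamma(\mathrm H_P;y)$. Furthermore, if $\mathrm{des}_0(\ell)=\ell'$, where $\ell$ (resp. $\ell'$) denotes the number of distinct labels above $\hat 0$ (resp. above any atom), then (iv) $\gamma(\underline{\mathrm H}_{[a,\hat 1]};y)\preceq\gamma(\underline{\mathrm H}_P;y)$.
   Context: All posets are finite, bounded (minimum $\hat 0$, maximum $\hat 1$) and graded with rank function $\mathrm{rk}$, $\mathrm{rk}(\hat 0)=0$; the rank of $P$ is $\mathrm{rk}(\hat 1)$; atoms are the elements of rank $1$. Write $s\lessdot t$ if $t$ covers $s$, and $\mathcal E(P)$ for the set of covering pairs. UMEL-shellability. An edge labeling is a map $\lambda:\mathcal E(P)\to\Lambda$ to a totally ordered set $(\Lambda,\vartriangleleft)$. It is an EL-labeling if for all $s\le t$ there is a unique maximal chain $s=u_0\lessdot\cdots\lessdot u_k=t$ of $[s,t]$ with weakly increasing labels $\lambda(u_0,u_1)\trianglelefteq\cdots\trianglelefteq\lambda(u_{k-1},u_k)$, and its label sequence is lexicographically minimal among all maximal chains of $[s,t]$. An EL-labeled poset is a pair $(P,\lambda)$ with $\lambda$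 an EL-labeling of $P$. For $s\in P$ let $\lambda_1\vartriangleleft\cdots\vartriangleleft\lambda_\ell$ be the distinct labels $\lambda(s,t)$, $t\gtrdot s$ (the labels above $s$). The width is $\omega_s(i)=|\{t: s\lessdot t,\ \lambda(s,t)=\lambda_i\}|$ (equal to $0$ for $i>\ell$). For $s\lessdot t$, $\mathrm{Ind}(s,t)$ is the $i$ with $\lambda(s,t)=\lambda_i$, and $\mathrm{des}_s(t)$ is the number of distinct labels above $t$ that are $\vartriangleleft\lambda(s,t)$. $(P,\lambda)$ is a rank-uniform labeled poset if (1) $\omega_s(i)=\omega_{s'}(i)$ for all $s,s'$ of the same rank and all $i\ge1$; and (2) $\mathrm{des}_s(t)=\mathrm{des}_{s'}(t')$ whenever $s\lessdot t$, $s'\lessdot t'$, $\mathrm{rk}(s)=\mathrm{rk}(s')$ and $\mathrm{Ind}(s,t)=\mathrm{Ind}(s',t')$. In that case $\mathrm{des}_k(i)$ denotes $\mathrm{des}_s(t)$ for any $s$ of rank $k$ and $t\gtrdot s$ with $\mathrm{Ind}(s,t)=i$, and $\ell_k$ is the number of distinct labels above any element of rank $k$. It is monotonic if for every $0\le k\le \mathrm{rk}(P)-1$ the function $i\mapsto\mathrm{des}_k(i)$ is weakly increasing on $\{1,\dots,\ell_k\}$. $P$ is UMEL-shellable if it admits an EL-labeling $\lambda$ such that $(P,\lambda)$ is a monotonic rank-uniform labeled poset. Chow polynomials. For $s<t$ let $\chi_{s,t}(x)=\sum_{w\in[s,t]}\mu(s,w)x^{\mathrm{rk}(t)-\mathrm{rk}(w)}$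 ($\mu$ the Möbius function) and $\overline\chi_{s,t}(x)=\chi_{s,t}(x)/(x-1)$. The Chow polynomial is defined recursively by $\underline{\mathrm H}_P(x)=1$ if $|P|=1$ and $\underline{\mathrm H}_P(x)=\sum_{s\in P\setminus\{\hat 0\}}\overline\chi_{\hat 0,s}(x)\,\underline{\mathrm H}_{[s,\hat 1]}(x)$ otherwise. The augmented Chow polynomial is $\mathrm H_P(x)=\sum_{s\in P}x^{\mathrm{rk}(s)}\,\underline{\mathrm H}_{[s,\hat 1]}(x)$. $\gamma$-polynomials. If $f(x)=x^df(x^{-1})$ then $f(x)=\sum_{i=0}^{\lfloor d/2\rfloor}\gamma_i x^i(1+x)^{d-2i}$ for unique reals $\gamma_i$, and $\gamma(f;y)=\sum_i\gamma_iy^i$. For $P$ of rank $n\geq 1$, $\underline{\mathrm H}_P$ is symmetric with $d=n-1$ and $\mathrm H_P$ is symmetric with $d=n$; for rank $0$ both polynomials, and their $\gamma$-polynomials, equal $1$. Interlacing. For real-rooted $f$ of degree $n$ with roots $\alpha_n\le\cdots\le\alpha_1$ and real-rooted $g$ of degree $n$ or $n+1$ with roots $(\beta_{n+1}\le)\,\beta_n\le\cdots\le\beta_1$ (positive leading coefficients), write $f\preceq g$ (''$f$ interlaces $g$'') if $(\beta_{n+1}\le)\,\alpha_n\le\beta_n\le\alpha_{n-1}\le\cdots\le\alpha_1\le\beta_1$. By convention $0\preceq f$, $f\preceq 0$, $0\preceq 0$ for every real-rooted $f$. *)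

(* Defs.v *)
From HB Require Import structures.
From mathcomp Require Import all_boot all_order all_algebra.
From mathcomp Require Import classical_sets.

Set Implicit Arguments.
Unset Strict Implicit.
Unset Printing Implicit Defensive.

Import Order.TTheory GRing.Theory Num.Theory.
Local Open Scope order_scope.

Section Posets.
Context {disp : Order.disp_t} {P : finTBPOrderType disp}.
Implicit Types s t u w : P.

Definition covers s t : bool := (s < t) && [forall w, ~~ ((s < w) && (w < t))].

(* A finite bounded poset is graded iff it has a rank function, which is then
   unique; [s, t] is itself graded, of rank [rk t - rk s]. *)
Definition is_rank (rk : P -> nat) : Prop :=
  rk \bot = 0%N /\ forall s t, covers s t -> rk t = (rk s).+1.

Section EdgeLabelings.
Context {dispL : Order.disp_t} {L : orderType dispL}.
(* Only the values of [lam] at covering pairs are ever used. *)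
Variable lam : P -> P -> L.

(* [s :: p] is a maximal chain of the interval [s, t]. *)
Definition maximal_chain s t (p : seq P) : bool :=
  path covers s p && (last s p == t).

Definition chain_labels s (p : seq P) : seq L := pairmap lam s p.

Definition weakly_increasing s (p : seq P) : bool :=
  sorted <=%O (chain_labels s p).

Definition EL_labeling : Prop :=
  forall s t, s <= t ->
    exists p : seq P,
      [/\ maximal_chain s t p, weakly_increasing s p,
          forall q, maximal_chain s t q -> weakly_increasing s q -> q = p
        & forall q, maximal_chain s t q ->
            (chain_labels s p : seqlexi L) <= (chain_labels s q : seqlexi L)].

(* The distinct labels above [s], in increasing order. *)
Definition labels_above s : seq L :=
  sort <=%O (undup [seq lam s t | t <- enum P & covers s t]).

Definition nlabels s : nat := size (labels_above s).

(* Indices of labels start at 1. *)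
Definition Ind s t : nat := (index (lam s t) (labels_above s)).+1.

Definition width s (i : nat) : nat :=
  #|[set t : P | covers s t && (Ind s t == i)]|.

Definition des s t : nat :=
  size [seq l <- labels_above t | l < lam s t].

Variable rk : P -> nat.

Definition rank_uniform : Prop :=
  (forall s s' i, rk s = rk s' -> (1 <= i)%N -> width s i = width s' i) /\
  (forall s t s' t', covers s t -> covers s' t' -> rk s = rk s' ->
     Ind s t = Ind s' t' -> des s t = des s' t').

(* [des_k k i] and [nlabels_k k] do not depend on the element picked when the
   labeling is rank-uniform; they are 0 when there is nothing to pick. *)
Definition des_k (k i : nat) : nat :=
  if [pick e : P * P | [&& covers e.1 e.2, rk e.1 == k & Ind e.1 e.2 == i]]
    is Some e then des e.1 e.2 else 0%N.

Definition nlabels_k (k : nat) : nat :=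
  if [pick s : P | rk s == k] is Some s then nlabels s else 0%N.

Definition monotonic : Prop :=
  forall k i j : nat, (k < rk \top)%N ->
    (1 <= i)%N -> (i <= j)%N -> (j <= nlabels_k k)%N ->
    (des_k k i <= des_k k j)%N.

End EdgeLabelings.

(* The first argument bounds the depth of the recursion; see [mobiusE]. *)
Fixpoint mobius_rec (n : nat) s t : int :=
  if n is n'.+1 then
    if s == t then 1%R
    else if s < t then (- \sum_(w : P | (s <= w < t)%O) mobius_rec n' s w)%R
    else 0%R
  else 0%R.

Definition mobius s t : int := mobius_rec #|P| s t.

Lemma mobiusE s t :
  mobius s t =
    if s == t then 1%R
    else if s < t then (- \sum_(w : P | (s <= w < t)%O) mobius s w)%R
    else 0%R.
Proof.
have cardlt (x y : P) : (x < y)%O -> (#|[pred w | (w < x)%O]| < #|[pred w | (w < y)%O]|)%N.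
  move=> xy; apply: proper_card; apply/fintype.properP; split.
    by apply/fintype.subsetP => w; rewrite !inE => /lt_trans; apply.
  by exists x; rewrite !inE ?ltxx.
have stable n m (x : P) : (#|[pred w | (w < x)%O]| < n)%N ->
    (#|[pred w | (w < x)%O]| < m)%N -> mobius_rec n s x = mobius_rec m s x.
  elim: n m x => [|n IHn] [|m] x //= ltn ltm.
  case: eqP => // _; case: ifP => // _; congr (- _)%R.
  apply: eq_bigr => w /andP[_ /cardlt ltw].
  by apply: IHn; apply: (leq_trans ltw).
have small (x : P) : (#|[pred w | (w < x)%O]| < #|P|)%N.
  apply: proper_card; apply/fintype.properP; split.
    by apply/fintype.subsetP => w; rewrite !inE.
  by exists x; rewrite !inE ?ltxx.
by rewrite /mobius (stable _ #|P|.+1 t (small t) (ltnW (small t))).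
Qed.

Section Chow.
Variables (R : fieldType) (rk : P -> nat).
Local Open Scope ring_scope.

Definition char_poly_itv s t : {poly R} :=
  \sum_(w : P | (s <= w <= t)%O)
     (mobius s w)%:~R *: 'X^(rk t - rk w).

(* For s < t the division is exact, 1 being a root of [char_poly_itv s t]. *)
Definition red_char_poly s t : {poly R} := char_poly_itv s t %/ ('X - 1).

Fixpoint chow_rec (n : nat) s t : {poly R} :=
  if n is n'.+1 then
    if s == t then 1
    else \sum_(w : P | (s < w <= t)%O)
           red_char_poly s w * chow_rec n' w t
  else 0.

(* The Chow polynomial of the poset [s, t], for s <= t; see [chowE]. *)
Definition chow s t : {poly R} := chow_rec #|P| s t.

Lemma chowE s t :
  chow s t =
    if s == t then 1
    else \sum_(w : P | (s < w <= t)%O) red_char_poly s w * chow w t.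
Proof.
have cardgt (x y : P) : (x < y)%O -> (#|[pred w | (y < w)%O]| < #|[pred w | (x < w)%O]|)%N.
  move=> xy; apply: proper_card; apply/fintype.properP; split.
    by apply/fintype.subsetP => w; rewrite !inE; apply: lt_trans.
  by exists y; rewrite !inE ?ltxx.
have stable n m (x : P) : (#|[pred w | (x < w)%O]| < n)%N ->
    (#|[pred w | (x < w)%O]| < m)%N -> chow_rec n x t = chow_rec m x t.
  elim: n m x => [|n IHn] [|m] x //= ltn ltm.
  case: eqP => // _; apply: eq_bigr => w /andP[/cardgt ltw _].
  by congr (_ * _); apply: IHn; apply: (leq_trans ltw).
have small (x : P) : (#|[pred w | (x < w)%O]| < #|P|)%N.
  apply: proper_card; apply/fintype.properP; split.
    by apply/fintype.subsetP => w; rewrite !inE.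
  by exists x; rewrite !inE ?ltxx.
by rewrite /chow (stable _ #|P|.+1 s (small s) (ltnW (small s))).
Qed.

(* The augmented Chow polynomial of the poset [s, t], for s <= t. *)
Definition aug_chow s t : {poly R} :=
  \sum_(w : P | (s <= w <= t)%O) 'X^(rk w - rk s) * chow w t.

End Chow.
End Posets.

Local Open Scope ring_scope.

Section Gamma.
Variable R : fieldType.
Implicit Types f g : {poly R}.

Definition symmetric_poly (d : nat) f : Prop :=
  (size f <= d.+1)%N /\ forall i, (i <= d)%N -> f`_i = f`_(d - i).

Definition gamma_expansion (d : nat) g : {poly R} :=
  \sum_(i < d./2.+1) g`_i *: ('X^i * (1 + 'X) ^+ (d - i.*2)).

Definition is_gamma (d : nat) f g : Prop :=
  (size g <= d./2.+1)%N /\ f = gamma_expansion d g.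

Lemma is_gamma_exists d f : symmetric_poly d f -> exists g, is_gamma d f g.
Proof.
have coef1X n i : ((1 + 'X : {poly R}) ^+ n)`_i = 'C(n, i)%:R.
  rewrite addrC exprD1n coef_sum; have [lein|ltni] := leqP i n.
    rewrite (bigD1 (Ordinal (lein : i < n.+1)%N)) //= coefMn coefXn eqxx.
    rewrite big1 ?addr0 // => j; rewrite -val_eqE /= coefMn coefXn eq_sym.
    by move=> /negPf->; rewrite mul0rn.
  rewrite bin_small // big1 // => j _.
  by rewrite coefMn coefXn gtn_eqF ?mul0rn // (leq_trans (ltn_ord j)).
have [m] := ubnP d; elim: m d f => // m IHm [|[|d]] f /ltnSE ledm [szf symf].
- exists f; split; rewrite // /gamma_expansion big_ord_recl big_ord0 addr0.
  by rewrite /= !expr0 mulr1 alg_polyC; exact: size1_polyC.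
- exists (f`_0)%:P; split; first by rewrite size_polyC leq_b1.
  rewrite /gamma_expansion big_ord_recl big_ord0 addr0 coefC /= expr0 mul1r.
  apply/polyP => i; rewrite coefZ coef1X.
  case: i => [|[|i]]; rewrite ?mulr1 //; first by rewrite (symf 1%N).
  by rewrite mulr0 nth_default // (leq_trans szf).
pose h : {poly R} := f - f`_0 *: (1 + 'X) ^+ d.+2.
have hE i : h`_i = f`_i - f`_0 * 'C(d.+2, i)%:R by rewrite coefB coefZ coef1X.
pose f' : {poly R} := \poly_(i < d.+1) h`_i.+1.
have hX : h = 'X * f'.
  apply/polyP => -[|i]; rewrite coefXM /= ?hE ?bin0 ?mulr1 ?subrr //.
  rewrite coef_poly; case: ltnP => [_|]; first by rewrite hE.
  rewrite leq_eqVlt => /orP[/eqP<-|ltdi].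
    by rewrite binn mulr1 (symf d.+2) // subnn subrr.
  by rewrite bin_small // mulr0 subr0 nth_default // (leq_trans szf).
have [||g' [szg' f'E]] := IHm d f'; first exact: ltn_trans ledm.
  split=> [|i leid]; first exact: size_poly.
  have e : (d.+2 - i.+1 = (d - i).+1)%N by rewrite subSS subSn.
  by rewrite !coef_poly !ltnS leid leq_subr !hE -e bin_sub ?(symf i.+1) // ltnW.
exists ((f`_0)%:P + 'X * g'); split.
  rewrite (leq_trans (size_polyD _ _)) // geq_max size_polyC.
  rewrite (leq_trans (leq_b1 _)) //= (leq_trans (size_polyMleq _ _)) //.
  by rewrite size_polyX /= ltnS.
rewrite /gamma_expansion big_ord_recl /= coefD coefC coefXM eqxx addr0.
rewrite expr0 mul1r subn0.
have fE : f = f`_0 *: (1 + 'X) ^+ d.+2 + h by rewrite addrC subrK.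
rewrite {1}fE; congr (_ + _).
rewrite hX f'E mulr_sumr; apply: eq_bigr => i _.
rewrite coefD coefC coefXM /= add0r -scalerAr mulrA -exprS.
by rewrite /bump /= add1n doubleS !subSS.
Qed.

Lemma is_gamma_unique d f g1 g2 : is_gamma d f g1 -> is_gamma d f g2 -> g1 = g2.
Proof.
move=> [sz1 fE1] [sz2 fE2]; apply/eqP; rewrite -subr_eq0; apply/eqP.
have e0 : gamma_expansion d (g1 - g2) = 0.
  apply/eqP; rewrite -(subrr f) {1}fE1 fE2 /gamma_expansion -sumrB; apply/eqP.
  by apply: eq_bigr => i _; rewrite coefB scalerBl.
apply/polyP => i; rewrite coef0; have [ltid|leid] := ltnP i d./2.+1; last first.
  by rewrite nth_default // (leq_trans (size_polyD _ _)) // size_polyN geq_max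
             !(leq_trans _ leid).
elim/ltn_ind: i ltid => i IHi ltid.
have: (gamma_expansion d (g1 - g2))`_i = 0 by rewrite e0 coef0.
rewrite coef_sum (bigD1 (Ordinal ltid)) //= coefZ coefXnM ltnn subnn.
rewrite -horner_coef0 horner_exp !hornerE expr1n mulr1 big1 ?addr0 // => j.
rewrite -val_eqE /= neq_ltn coefZ coefXnM => /orP[ltji|->]; last by rewrite mulr0.
by rewrite IHi // mul0r.
Qed.

(* The polynomial gamma(f; y), for f symmetric with center d / 2
   (0 when f has no gamma-expansion). *)
Definition gamma_poly (d : nat) f : {poly R} := xget 0 (is_gamma d f).

Lemma gamma_polyP d f : symmetric_poly d f -> is_gamma d f (gamma_poly d f).
Proof. by move/is_gamma_exists => ex; exact: (@xgetPex _ 0 (is_gamma d f)). Qed.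

Lemma gamma_polyE d f g : is_gamma d f g -> gamma_poly d f = g.
Proof.
by move=> fg; apply: (is_gamma_unique _ fg); exact: (@xgetI _ 0 (is_gamma d f) g).
Qed.

End Gamma.

Section ChowGamma.
Context {disp : Order.disp_t} {P : finTBPOrderType disp}.
Variables (R : fieldType) (rk : P -> nat).

(* In rank 0 the truncated predecessor gives center 0, and the value 1. *)
Definition gamma_chow (s t : P) : {poly R} :=
  gamma_poly (rk t - rk s).-1 (chow R rk s t).

Definition gamma_aug_chow (s t : P) : {poly R} :=
  gamma_poly (rk t - rk s) (aug_chow R rk s t).

End ChowGamma.

Section Interlacing.
Variable R : realFieldType.
Implicit Types f g : {poly R}.

(* [s] lists the roots of [f] with multiplicity, from largest to smallest. *)
Definition roots_desc f (s : seq R) : Prop :=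
  f = lead_coef f *: \prod_(a <- s) ('X - a%:P) /\ sorted >=%R s.

Definition real_rooted f : Prop := exists s, roots_desc f s.

Definition interlaces f g : Prop :=
  (f = 0 /\ real_rooted g) \/ (g = 0 /\ real_rooted f) \/
  [/\ 0 < lead_coef f, 0 < lead_coef g
   & exists al be : seq R,
     [/\ roots_desc f al, roots_desc g be,
         size be = size al \/ size be = (size al).+1,
         forall i, (i < size al)%N -> al`_i <= be`_i
       & forall i, (i.+1 < size be)%N -> be`_i.+1 <= al`_i]].

End Interlacing.

(* Main.v *)
Require Import Defs.
From HB Require Import structures.
From mathcomp Require Import all_boot all_order all_algebra.
From mathcomp Require Import boolp polyrcf ring zify.

(** Both gamma-polynomials count maximal chains.  Fix the EL-labeling and say
    that a chain has a descent at an inner element when the label of the step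
    leaving it is smaller than the label of the step reaching it.  For an edge
    (s, t), consider the maximal chains of [s, 1] that start with this edge and
    do not have two consecutive descents; let A(s,t) be their generating
    polynomial by number of descents, and B(s,t) the part of it coming from the
    chains without a descent at t.  Then gamma(H_[s,1]) is the sum of the A(s,t)
    over the covers t of s, and gamma of the (non-augmented) Chow polynomial is
    the sum of the B(s,t) ([gamma_aug_chowE] and [gamma_chowE]).

    To see this, homogenize A and B by the gamma-expansion.  Removing the first
    edge gives B = U A + [t = 1] and A = (1 + x) B + x D B, where U and D sum
    over the next edges with a weakly larger, respectively smaller, label.
    Because each interval has exactly one rising chain, summing a function over
    all w > s is the same as summing it over rising chains, that is, summing the
    series of the powers of U; this turns the two equations into
    sum_(w >= s) (x^(rk w - rk s) - x) h_w = 1 - x for h_s = sum_t B(s,t)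
    ([aug_chow_sum_rel]).  Moebius inversion changes this relation into the
    recursion that defines the Chow polynomial.

    In a rank-uniform poset A(s,t) and B(s,t) depend only on the rank of s and
    the index i of the label.  Write A_i and B_i for them, and
    A_i = B_i + y C_i.  With primes for the next rank and d_i = des(i), we have
    B_i = sum_(j > d_i) A'_j and C_i = sum_(j <= d_i) B'_j.  Monotonicity of d
    makes the following properties pass from one rank to the rank below it:
    the B_i interlace each other in the order of the indices, so do the A_i,
    and each C_i interlaces each B_j ([edges_interlace]).  The only tools are
    that the polynomials interlacing a given one, and those interlaced by a
    given one, are closed under addition ([ilcDl], [ilcDr]), and that f
    interlaces g if and only if g interlaces y f when all roots are nonpositive.
    The interlacings to be proved are further sums of the same kind. *)

Set Implicit Arguments.
Unset Strict Implicit.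
Unset Printing Implicit Defensive.

Import Order.TTheory GRing.Theory Num.Theory.
Local Open Scope ring_scope.

(** * Interlacing of real root lists, by counting roots *)

Section RootCounts.
Variable R : rcfType.
Implicit Types (s t u : seq R) (f g : {poly R}) (x : R).

Definition root_prod s : {poly R} := \prod_(a <- s) ('X - a%:P).
Definition roots_gt s x := count (fun a => x < a) s.
Definition roots_ge s x := count (fun a => x <= a) s.

Arguments roots_gt : simpl never.
Arguments roots_ge : simpl never.

(** The interlacing of two multisets of reals.  Counting the entries to the
    right of each point, instead of comparing sorted lists, makes the relation
    invariant under permutations and under a common additional entry; both
    counts together also control multiplicities. *)
Definition alternate s t := forall x,
  ((roots_gt s x <= roots_gt t x <= (roots_gt s x).+1) &&
   (roots_ge s x <= roots_ge t x <= (roots_ge s x).+1))%N.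

Lemma root_prod_cons a s : root_prod (a :: s) = ('X - a%:P) * root_prod s.
Proof. exact: big_cons. Qed.

Lemma perm_root_prod s s' : perm_eq s s' -> root_prod s = root_prod s'.
Proof. exact: perm_big. Qed.

Lemma root_prod_rem a s : a \in s -> root_prod s = ('X - a%:P) * root_prod (rem a s).
Proof. by move=> /perm_to_rem/perm_root_prod->; rewrite root_prod_cons. Qed.

Lemma perm_alternate s s' t t' :
  perm_eq s s' -> perm_eq t t' -> alternate s t -> alternate s' t'.
Proof.
move=> /permP ss' /permP tt' st x; have := st x.
by rewrite /roots_gt /roots_ge !ss' !tt'.
Qed.

Lemma alternate_cons a s t : alternate (a :: s) (a :: t) <-> alternate s t.
Proof.
by split=> st x; have := st x; rewrite /roots_gt /roots_ge /=; lia.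
Qed.

Lemma alternate_rem a s t : a \in s -> a \in t ->
  alternate (rem a s) (rem a t) <-> alternate s t.
Proof.
move=> sa ta; rewrite -(alternate_cons a); split; apply: perm_alternate;
  by rewrite ?perm_to_rem // perm_sym perm_to_rem.
Qed.

Lemma alternate_refl s : alternate s s.
Proof. by move=> x; rewrite !leqnn !leqnSn. Qed.

Lemma roots_geE s x : roots_ge s x = (roots_gt s x + count_mem x s)%N.
Proof.
by elim: s => //= a s; rewrite /roots_ge /roots_gt /= => ->; case: ltgtP; lia.
Qed.

Lemma roots_gt0 s x : (forall y, y \in s -> y <= x) -> roots_gt s x = 0%N.
Proof.
move=> sx; apply/eqP; rewrite -leqn0 leqNgt -has_count; apply/hasP => -[y ys].
by rewrite ltNge sx.
Qed.

Lemma roots_ge0 s x : (forall y, y \in s -> y < x) -> roots_ge s x = 0%N.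
Proof.
move=> sx; apply/eqP; rewrite -leqn0 leqNgt -has_count; apply/hasP => -[y ys].
by rewrite leNgt sx.
Qed.

Lemma horner_root_prod s x :
  (root_prod s).[x] = (-1) ^+ roots_gt s x * `|(root_prod s).[x]|.
Proof.
elim: s => [|a s IH]; first by rewrite /root_prod big_nil hornerC normr1 mulr1.
rewrite root_prod_cons hornerM hornerXsubC normrM {1}IH /roots_gt /=.
case: (ltP x a) => xa; rewrite ?add1n ?add0n ?exprS.
  by rewrite [`|x - a|]ltr0_norm ?subr_lt0 //; ring.
by rewrite [`|x - a|]ger0_norm ?subr_ge0 //; ring.
Qed.

Lemma root_root_prod s x : root (root_prod s) x = (x \in s).
Proof. exact: root_prod_XsubC. Qed.

(** The sign of a polynomial at the roots of one that interlaces it.  When x is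
    not in t, the count of entries of t changes at x together with that of s,
    hence there is exactly one more entry of t beyond x than there is of s. *)
Lemma alternate_sign s t x : uniq s -> alternate s t -> x \in s ->
  0 <= (-1) ^+ (roots_gt s x).+1 * (root_prod t).[x] ?= iff (x \in t).
Proof.
move=> us st xs; have := st x; rewrite !roots_geE (count_uniq_mem _ us) xs.
move=> stx; rewrite -root_root_prod rootE; split; last first.
  by rewrite eq_sym mulf_eq0 signr_eq0.
have [xt|xt] := boolP (x \in t).
  by move: xt; rewrite -root_root_prod rootE => /eqP->; rewrite mulr0.
have e : roots_gt t x = (roots_gt s x).+1.
  by move: stx xt; rewrite -has_pred1 has_count; clear; lia.
by rewrite horner_root_prod -e mulrA -signr_odd -expr2 sqrr_sign mul1r.
Qed.

(** Intermediate value theorem between any two consecutive points of a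
    decreasing sequence along which the signs of g alternate. *)
Lemma alternating_roots g s a k : path >%R a s ->
    0 < (-1) ^+ k * g.[a] ->
    (forall x, x \in s -> 0 < (-1) ^+ (k + roots_gt s x).+1 * g.[x]) ->
  exists t, [/\ size t = size s, uniq t, all (root g) t,
                {in t, forall x, x < a} & alternate s t].
Proof.
elim: s a k => [|b s IH] a k /=; first by exists [::]; split=> //; apply: alternate_refl.
case/andP=> ba pbs ga gs.
have sb x : x \in s -> x < b.
  by move=> xs; move: pbs; rewrite path_sortedE; [case/andP=> /allP/(_ _ xs)|
     by move=> ? ? ? h1 h2; apply: lt_trans h2 h1].
have gb : 0 < (-1) ^+ k.+1 * g.[b].
  have := gs b; rewrite mem_head => /(_ isT).
  have -> : roots_gt (b :: s) b = 0%N; last by rewrite addn0.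
  by apply: roots_gt0 => y; rewrite inE => /orP[/eqP->//|/sb/ltW].
have [|t [szt ut rt tb st]] := IH b k.+1 pbs gb.
  move=> x xs; have := gs x; rewrite inE xs orbT => /(_ isT).
  by rewrite {1}/roots_gt /= sb // add1n addnS addSn.
have [c cab rc] : {c | c \in `]b, a[ & root g c}.
  apply: poly_ivtoo; first exact: ltW.
  have := mulr_gt0 ga gb; rewrite exprS mulN1r mulNr mulrN mulrACA -expr2.
  by rewrite sqrr_sign mul1r oppr_gt0 mulrC.
move: cab; rewrite in_itv /= => /andP[bc ca].
have ct : c \notin t by apply/negP => /tb; rewrite ltNge (ltW bc).
exists (c :: t); split=> //=; rewrite ?szt ?ct ?rc //.
  by move=> x; rewrite inE => /orP[/eqP->//|/tb xb]; apply: lt_trans ba.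
move=> x; have := st x; rewrite /roots_gt /roots_ge /=.
rewrite -!/(roots_gt _ _) -!/(roots_ge _ _) => stx.
have l1 : (x < b -> x < c) by move=> h; apply: lt_trans bc.
have l2 : (x <= b -> x <= c) by move=> h; apply: le_trans (ltW bc).
have h1 : b <= x -> roots_gt s x = 0%N /\ roots_gt t x = 0%N.
  move=> bx; split; apply: roots_gt0 => y.
    by move=> /sb/ltW/le_trans; apply.
  by move=> /tb/ltW/le_trans; apply.
have h2 : b < x -> roots_ge s x = 0%N /\ roots_ge t x = 0%N.
  move=> bx; split; apply: roots_ge0 => y.
    by move=> /sb/lt_trans; apply.
  by move=> /tb/lt_trans; apply.
case: (ltgtP x b) => xb.
- by rewrite l1 // l2 ?(ltW xb) //; move: stx; clear; lia.
- have [e1 e2] := h1 (ltW xb); have [e3 e4] := h2 xb.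
  by rewrite e1 e2 e3 e4; case: (x < c); case: (x <= c).
- have xb' : b <= x by rewrite xb.
  have [e1 e2] := h1 xb'; move: stx l2; rewrite e1 e2 -?xb lexx => h /(_ isT)->.
  by move: h; case: (x < c); clear; lia.
Qed.

Lemma lead_coefD_pos f g : 0 < lead_coef f -> 0 < lead_coef g ->
  0 < lead_coef (f + g) /\ size (f + g) = maxn (size f) (size g).
Proof.
wlog fg : f g / (size f <= size g)%N => [hw|] lf lg.
  case/orP: (leq_total (size f) (size g)) => [fg|gf]; first exact: hw.
  by rewrite addrC maxnC; apply: hw.
move: fg; rewrite leq_eqVlt => /orP[/eqP fg|fg]; last first.
  by rewrite addrC lead_coefDl // size_polyDl //; split; last lia.
have lfg : (f + g)`_(size g).-1 = lead_coef f + lead_coef g.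
  by rewrite coefD /lead_coef fg.
have pos : 0 < lead_coef f + lead_coef g by rewrite addr_gt0.
have sz : size (f + g) = size g.
  apply/eqP; rewrite eqn_leq; apply/andP; split.
    by rewrite (leq_trans (size_polyD _ _)) // fg maxnn.
  have g0 : (0 < size g)%N by rewrite size_poly_gt0 -lead_coef_eq0 gt_eqF.
  by rewrite -(prednK g0) ltnNge; apply/negP => /leq_sizeP/(_ _ (leqnn _)) e;
     move: pos; rewrite -lfg e ltxx.
by rewrite /lead_coef sz -/(lead_coef _) lfg fg maxnn.
Qed.

Lemma lead_coef_root_prod c s : lead_coef (c *: root_prod s) = c.
Proof. by rewrite lead_coefZ (monicP (monic_prod_XsubC _ _ _)) mulr1. Qed.

Lemma size_root_prod c s : c != 0 -> size (c *: root_prod s) = (size s).+1.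
Proof. by move=> c0; rewrite size_scale // size_prod_XsubC. Qed.

Lemma upper_bound s : exists M, forall x, x \in s -> x < M.
Proof.
exists (1 + \sum_(x <- s) `|x|) => x xs.
rewrite (big_rem x) //= addrCA; apply: le_lt_trans (ler_norm x) _.
by rewrite ltrDl ltr_wpDr ?ltr01 // sumr_ge0.
Qed.

Lemma lower_bound s : exists M, forall x, x \in s -> M < x.
Proof.
have [M hM] := upper_bound (map -%R s); exists (- M) => x xs.
by rewrite ltrNl; apply: hM; apply: map_f.
Qed.

(** Count the entries to the right of a point that lies below all of them. *)
Lemma alternate_size s t : alternate s t -> (size s <= size t <= (size s).+1)%N.
Proof.
have [M hM] := lower_bound (s ++ t) => /(_ M).
have e u : {subset u <= s ++ t} -> roots_gt u M = size u.
  by move=> us; apply/eqP; rewrite -all_count; apply/allP => x /us/hM.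
by rewrite !e => [/andP[]||] // x; rewrite mem_cat => ->; rewrite ?orbT.
Qed.

(** Without a root common to all three lists, s has no repetition, and at each
    of its entries the two summands have weakly the same sign and do not both
    vanish.  So the signs of the sum alternate strictly along s, and it has a
    root in each gap and one to the right of s.  The degree leaves room for at
    most one more root; it is real, and its position to the left of s follows
    from the sign of the remaining linear factor at the entries of s. *)
Lemma alternate_add_coprime s t1 t2 c1 c2 :
    0 < c1 -> 0 < c2 -> alternate s t1 -> alternate s t2 ->
    {in s, forall a, ~~ ((a \in t1) && (a \in t2))} ->
  exists t c, [/\ 0 < c, alternate s t &
     c1 *: root_prod t1 + c2 *: root_prod t2 = c *: root_prod t].
Proof.
move=> c1p c2p st1 st2 nst.
wlog sorted_s : s st1 st2 nst / sorted >=%R s => [hw|].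
  have pS := permEl (perm_sort >=%R s).
  have [||||t [c [cp st e]]] := hw (sort >=%R s).
  - by apply: perm_alternate st1; rewrite // perm_sym.
  - by apply: perm_alternate st2; rewrite // perm_sym.
  - by move=> x; rewrite mem_sort; apply: nst.
  - exact: (sort_sorted (fun x y => le_total y x)).
  by exists t, c; split=> //; apply: perm_alternate st.
have us : uniq s.
  apply/count_mem_uniq => x; case: (boolP (x \in s)) => xs; last by apply/count_memPn.
  have := nst x xs; rewrite -!has_pred1 !has_count.
  have := st1 x; have := st2 x; rewrite !roots_geE.
  have : (0 < count_mem x s)%N by rewrite -has_count has_pred1.
  by clear; lia.
set g := _ + _.
have gs x : x \in s -> 0 < (-1) ^+ (0 + roots_gt s x).+1 * g.[x].
  move=> xs; rewrite add0n /g hornerD !hornerZ mulrDr.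
  have [h1 e1] := alternate_sign us st1 xs; have [h2 e2] := alternate_sign us st2 xs.
  rewrite (mulrCA _ c1) (mulrCA _ c2).
  have := nst x xs; rewrite -{}e1 -{}e2; case: eqP => [<- /=|/eqP n1 _].
    by rewrite mulr0 add0r => n2; rewrite mulr_gt0 // lt_neqAle n2.
  apply: ltr_pwDl; first by rewrite mulr_gt0 // lt_neqAle n1.
  by rewrite mulr_ge0 // ltW.
have [M hM] := upper_bound (s ++ t1 ++ t2).
(* The point M beyond all roots, where the sum is positive, is the right end of
   the sequence to which the intermediate value theorem is applied. *)
have gM : 0 < (-1) ^+ 0 * g.[M].
  rewrite expr0 mul1r /g hornerD !hornerZ.
  have p u c : 0 < c -> {subset u <= s ++ t1 ++ t2} -> 0 < c * (root_prod u).[M].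
    move=> cp uM; rewrite mulr_gt0 // horner_root_prod roots_gt0 ?mul1r.
      by rewrite normr_gt0 -rootE root_root_prod; apply/negP => /uM/hM; rewrite ltxx.
    by move=> y /uM/hM/ltW.
  by rewrite addr_gt0 // p // => x xt; rewrite !mem_cat xt ?orbT.
have pM : path >%R M s.
  rewrite path_sortedE; last by move=> ? ? ? h1 h2; apply: lt_trans h2 h1.
  apply/andP; split; first by apply/allP => x xs; apply: hM; rewrite mem_cat xs.
  by rewrite -(rev_sorted <%R) lt_sorted_uniq_le rev_uniq us rev_sorted.
have [t [szt ut rt _ st]] := alternating_roots pM gM gs.
have [lg szg] : 0 < lead_coef g /\ size g = maxn (size t1).+1 (size t2).+1.
  by have := @lead_coefD_pos (c1 *: root_prod t1) (c2 *: root_prod t2);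
     rewrite !lead_coef_root_prod !size_root_prod ?gt_eqF //; apply.
have [q gE] : exists q, g = q * root_prod t.
  by apply: uniq_roots_prod_XsubC; rewrite ?uniq_rootsE.
have lq : 0 < lead_coef q.
  by move: lg; rewrite gE lead_coef_Mmonic ?monic_prod_XsubC.
have q0 : q != 0 by rewrite -lead_coef_eq0 gt_eqF.
have szq : size g = (size q + size s)%N.
  by rewrite gE size_Mmonic ?monic_prod_XsubC // size_prod_XsubC addnS szt.
have [q1|q1] := leqP (size q) 1.
  exists t, (lead_coef q); split=> //.
  by rewrite gE {1}(size1_polyC q1) mul_polyC lead_coefE; case: (size q) q1 => [|[]].
have {}q1 : size q = 2%N.
  have := alternate_size st1; have := alternate_size st2.
  by move: q1 szq; rewrite szg; clear; lia.
pose b := - q`_0 / lead_coef q.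
have qE : q = lead_coef q *: ('X - b%:P).
  apply/polyP => -[|[|i]]; rewrite coefZ coefB coefX coefC /=.
  - by rewrite sub0r mulrN mulrC divfK ?gt_eqF // opprK.
  - by rewrite subr0 mulr1 lead_coefE q1.
  - by rewrite subr0 mulr0 nth_default // q1.
exists (b :: t), (lead_coef q); split=> //; last first.
  by rewrite gE {1}qE root_prod_cons scalerAl.
have bs x : x \in s -> b < x.
  move=> xs; have := gs x xs; rewrite gE hornerM add0n.
  have xt : x \notin t.
    apply/negP; rewrite -root_root_prod rootE => /eqP xt.
    by have := gs x xs; rewrite gE hornerM xt !mulr0 ltxx.
  have e : roots_gt t x = (roots_gt s x).+1.
    by have := st x; rewrite !roots_geE (count_uniq_mem _ us) xs (count_memPn xt); clear; lia.
  rewrite [X in _ * (_ * X)]horner_root_prod -e mulrCA mulrA -signr_odd.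
  rewrite mulrA -mulrA -!mulrA [X in _ * X]mulrA -expr2 sqrr_sign mul1r.
  have n0 : 0 < `|(root_prod t).[x]| by rewrite normr_gt0 -rootE root_root_prod.
  by rewrite pmulr_lgt0 // qE hornerZ hornerXsubC pmulr_rgt0 // subr_gt0.
move=> x; have := st x; rewrite /roots_gt /roots_ge /=.
rewrite -!/(roots_gt _ _) -!/(roots_ge _ _).
have szc u (p : pred R) : (count p u <= size u)%N by exact: count_size.
have := szc s (fun a => x < a); have := szc t (fun a => x < a).
have := szc s (fun a => x <= a); have := szc t (fun a => x <= a).
rewrite -!/(roots_gt _ _) -!/(roots_ge _ _).
have h1 : x < b -> roots_gt s x = size s.
  by move=> xb; apply/eqP; rewrite -all_count; apply/allP => y /bs; apply: lt_trans.
have h2 : x <= b -> roots_ge s x = size s.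
  by move=> xb; apply/eqP; rewrite -all_count; apply/allP => y /bs/ltW; apply: le_trans.
case: (ltgtP x b) => xb.
- by have := h1 xb; have := h2 (ltW xb); clear -szt; lia.
- by clear; lia.
- by move: h2; rewrite xb lexx => /(_ isT); clear -szt; lia.
Qed.

(** Common roots can be divided out of all three polynomials. *)
Lemma alternate_add s t1 t2 c1 c2 :
    0 < c1 -> 0 < c2 -> alternate s t1 -> alternate s t2 ->
  exists t c, [/\ 0 < c, alternate s t &
     c1 *: root_prod t1 + c2 *: root_prod t2 = c *: root_prod t].
Proof.
move=> c1p c2p; have [n] := ubnP (size s); elim: n s t1 t2 => // n IH s t1 t2 szs st1 st2.
case: (boolP (has (fun a => (a \in t1) && (a \in t2)) s)) => [/hasP[a sa /andP[a1 a2]]|];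
    last first.
  by move=> /hasPn; apply: alternate_add_coprime.
have [||| t [c [cp st e]]] := IH (rem a s) (rem a t1) (rem a t2).
- by move: szs; rewrite (perm_size (perm_to_rem sa)) /= ltnS.
- by apply/alternate_rem.
- by apply/alternate_rem.
exists (a :: t), c; split=> //.
  by apply: perm_alternate ((alternate_cons a _ _).2 st); rewrite // perm_sym perm_to_rem.
by rewrite (root_prod_rem a1) (root_prod_rem a2) root_prod_cons !scalerAr -mulrDr e.
Qed.
End RootCounts.

(** * Interlacing polynomials with nonpositive roots *)

Section Interlaced.
Variable R : rcfType.
Implicit Types (s t : seq R) (f g h : {poly R}) (x : R).

Definition nonpos_rooted f s :=
  [/\ 0 < lead_coef f, f = lead_coef f *: root_prod s & all (<= 0) s].

(** Unlike in [interlaces], nothing is asked of g when f = 0, nor of f when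
    g = 0.  Otherwise the relation would not be closed under addition of
    right-hand sides for f = 0, as two real-rooted polynomials may have a sum
    that is not.  Real-rootedness is then expressed by [ilc f f]. *)
Definition ilc f g := f = 0 \/ g = 0 \/
  exists s t, [/\ nonpos_rooted f s, nonpos_rooted g t & alternate s t].

Lemma nonpos_rootedP c s : 0 < c -> all (<= 0) s -> nonpos_rooted (c *: root_prod s) s.
Proof. by move=> cp s0; split; rewrite ?lead_coef_root_prod. Qed.

Lemma nonpos_rooted_neq0 f s : nonpos_rooted f s -> f != 0.
Proof. by case=> lf _ _; rewrite -lead_coef_eq0 gt_eqF. Qed.

Lemma nonpos_rooted_root f s : nonpos_rooted f s -> root f =i s.
Proof.
by case=> lf fE _ x; rewrite -root_root_prod [in LHS]fE -[LHS]/(root _ x) rootZ ?gt_eqF.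
Qed.

Lemma nonpos_rooted_perm f s s' :
  nonpos_rooted f s -> nonpos_rooted f s' -> perm_eq s s'.
Proof.
case=> lf fE _ [_ fE' _]; apply: prod_XsubC_eq.
by apply: (scalerI (lt0r_neq0 lf)); rewrite -[LHS]fE -[RHS]fE'.
Qed.

Lemma nonpos_rooted_gt0 f s x : nonpos_rooted f s -> 0 < x -> 0 < f.[x].
Proof.
move=> [lf -> s0] x0; rewrite hornerZ mulr_gt0 // horner_root_prod roots_gt0.
  rewrite mul1r normr_gt0 -rootE root_root_prod.
  by apply/negP => /(allP s0) /=; rewrite leNgt x0.
by move=> y /(allP s0) y0; apply: le_trans (ltW x0).
Qed.

Lemma nonpos_rootedX f s : nonpos_rooted f s -> nonpos_rooted ('X * f) (0 :: s).
Proof.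
case=> lf fE s0; have lX : lead_coef ('X * f) = lead_coef f.
  by rewrite mulrC lead_coefMX.
split; rewrite ?lX //=; last by rewrite lexx.
by rewrite root_prod_cons subr0 scalerAr -fE.
Qed.

(** Effect on roots of a multiplication by X: a largest entry 0 is added to the
    interlacing list, which thereby becomes the interlaced one. *)
Lemma alternate0 s t : all (<= 0) s -> all (<= 0) t ->
  alternate t (0 :: s) <-> alternate s t.
Proof.
have gt0 u x : all (<= 0) u -> 0 <= x -> roots_gt u x = 0%N.
  by move=> u0 x0; apply: roots_gt0 => y /(allP u0)/le_trans; apply.
have ge0 u x : all (<= 0) u -> 0 < x -> roots_ge u x = 0%N.
  by move=> u0 x0; apply: roots_ge0 => y /(allP u0)/le_lt_trans; apply.
move=> s0 t0; split=> st x; have := st x; rewrite /roots_gt /roots_ge /=;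
  rewrite -!/(roots_gt _ _) -!/(roots_ge _ _).
  case: (ltgtP x 0) => x0; first by lia.
    by rewrite !gt0 ?ge0 // ltW.
  by rewrite !(gt0 _ x) ?x0 //; lia.
case: (ltgtP x 0) => x0; first by lia.
  by rewrite !gt0 ?ge0 // ltW.
by rewrite !(gt0 _ x) ?x0 //; lia.
Qed.

Lemma ilc0f f : ilc 0 f. Proof. by left. Qed.
Lemma ilcf0 f : ilc f 0. Proof. by right; left. Qed.

Lemma ilc11 : ilc 1 1.
Proof.
right; right; exists [::], [::].
by split; [split; rewrite ?lead_coef1 // /root_prod big_nil scale1r..|exact: alternate_refl].
Qed.

(** The roots of the sum stay nonpositive because both summands are positive on
    the positive axis. *)
Lemma ilcDr f g1 g2 : ilc f g1 -> ilc f g2 -> ilc f (g1 + g2).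
Proof.
move=> [->|[->|[s [t1 [fs g1t st1]]]]]; first by left.
  by rewrite add0r.
move=> [f0|[->|[s' [t2 [fs' g2t st2]]]]].
- by have := nonpos_rooted_neq0 fs; rewrite f0 eqxx.
- by rewrite addr0; right; right; exists s, t1.
have {}st2 : alternate s t2 := perm_alternate (nonpos_rooted_perm fs' fs) (perm_refl _) st2.
have [t [c [cp st e]]] := alternate_add (let: And3 h _ _ := g1t in h)
  (let: And3 h _ _ := g2t in h) st1 st2.
have {}e : g1 + g2 = c *: root_prod t by case: g1t => _ -> _; case: g2t => _ -> _.
right; right; exists s, t; split=> //; rewrite e; apply: nonpos_rootedP => //.
apply/allP => x; rewrite -root_root_prod -(rootZ _ _ (lt0r_neq0 cp)) -e.
rewrite /= leNgt; apply: contraL => x0; rewrite rootE hornerD gt_eqF //.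
by rewrite addr_gt0 ?(nonpos_rooted_gt0 g1t) ?(nonpos_rooted_gt0 g2t).
Qed.

Lemma ilc_mulX f g : ilc f g -> ilc g ('X * f).
Proof.
move=> [->|[->|[s [t [fs gt st]]]]]; rewrite ?mulr0; [exact: ilcf0|exact: ilc0f|].
right; right; exists t, (0 :: s); split=> //; first exact: nonpos_rootedX.
by apply/alternate0 => //; [case: fs|case: gt].
Qed.

Lemma ilc_mulXI f g : ilc g ('X * f) -> ilc f g.
Proof.
move=> [->|[|[t [u [gt fu tu]]]]]; first exact: ilcf0.
  by move/eqP; rewrite mulf_eq0 polyX_eq0 => /eqP->; apply: ilc0f.
have u0 : 0 \in u.
  rewrite -(nonpos_rooted_root fu); rewrite -[_ \in _]/(root _ _).
  by rewrite rootM rootX eqxx.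
have lX : lead_coef ('X * f) = lead_coef f by rewrite mulrC lead_coefMX.
case: fu; rewrite lX (root_prod_rem u0) subr0 scalerAr => lf fE.
have {}fE : f = lead_coef f *: root_prod (rem 0 u).
  by apply: (mulfI _ fE); rewrite polyX_eq0.
rewrite (perm_all _ (perm_to_rem u0)) => /andP[_ r0].
right; right; exists (rem 0 u), t; split=> //.
apply/alternate0 => //; first by case: gt.
by apply: perm_alternate tu; rewrite // perm_to_rem.
Qed.

(** Multiplication by X exchanges the two sides, so this is the closure on the
    right. *)
Lemma ilcDl f1 f2 g : ilc f1 g -> ilc f2 g -> ilc (f1 + f2) g.
Proof.
by move=> /ilc_mulX h1 /ilc_mulX h2; apply: ilc_mulXI; rewrite mulrDr; apply: ilcDr.
Qed.

Lemma ilc_reflr f g : f != 0 -> ilc f g -> ilc g g.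
Proof.
move=> /eqP f0 [//|[->|[s [t [_ gt _]]]]]; first exact: ilcf0.
by right; right; exists t, t; split=> //; apply: alternate_refl.
Qed.

Lemma ilc_reflD f g : ilc f f -> ilc g g -> ilc f g -> ilc (f + g) (f + g).
Proof.
move=> ff gg fg; have [->|f0] := eqVneq f 0; first by rewrite add0r.
by apply: (ilc_reflr f0); apply: ilcDr.
Qed.

Lemma ilc_sumr (I : Type) (r : seq I) (Q : pred I) f (G : I -> {poly R}) :
  (forall i, Q i -> ilc f (G i)) -> ilc f (\sum_(i <- r | Q i) G i).
Proof. by move=> h; apply: big_ind => //; [apply: ilcf0|apply: ilcDr]. Qed.

Lemma ilc_suml (I : Type) (r : seq I) (Q : pred I) g (F : I -> {poly R}) :
  (forall i, Q i -> ilc (F i) g) -> ilc (\sum_(i <- r | Q i) F i) g.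
Proof.
move=> h; apply: (big_ind (fun f => ilc f g)) => //; first exact: ilc0f.
by move=> ? ?; apply: ilcDl.
Qed.

Lemma ilc_sum (I J : finType) (Q : pred I) (Q' : pred J) (F : I -> {poly R}) G :
  (forall i j, Q i -> Q' j -> ilc (F i) (G j)) ->
  ilc (\sum_(i | Q i) F i) (\sum_(j | Q' j) G j).
Proof. by move=> h; apply: ilc_suml => i Qi; apply: ilc_sumr => j; apply: h. Qed.

(** Sums of a family that is interlacing in the order of idx are real-rooted:
    add the terms from the last to the first, each one interlaces the sum of
    those after it. *)
Lemma ilc_sum_refl (I : finType) (idx : I -> nat) (Q : pred I) (F : I -> {poly R}) :
  (forall i j, Q i -> Q j -> (idx i <= idx j)%N -> ilc (F i) (F j)) ->
  ilc (\sum_(i | Q i) F i) (\sum_(i | Q i) F i).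
Proof.
move=> hF; pose le := relpre idx leq.
have tot : total le by move=> i j; apply: leq_total.
have tr : transitive le by move=> i j k; apply: leq_trans.
have -> : \sum_(i | Q i) F i = \sum_(i <- sort le (enum Q)) F i.
  by rewrite (perm_big _ (permEl (perm_sort _ _))) big_enum.
have : all Q (sort le (enum Q)) by apply/allP => i; rewrite mem_sort mem_enum.
have := sort_sorted tot (enum Q); elim: (sort _ _) => [|i r IH].
  by move=> _ _; rewrite big_nil; apply: ilc0f.
rewrite /= path_sortedE // => /andP[/allP ir /IH{}IH] /andP[Qi Qr].
rewrite big_cons; apply: ilc_reflD; [exact: hF|exact: IH|].
rewrite big_seq; apply: ilc_sumr => j jr; apply: hF => //; last exact: ir.
exact: (allP Qr).
Qed.

Lemma nth_roots_ge s i x : sorted >=%R s ->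
  (i < size s)%N -> (x <= s`_i) = (i < roots_ge s x)%N.
Proof.
elim: s i => // a s IH [|i] //=.
  rewrite /roots_ge /= -/(roots_ge s x); case: (leP x a) => //= xa.
  rewrite path_sortedE => [/andP[/allP sa _] _|]; last first.
    by move=> ? ? ? h1 h2; apply: le_trans h2 h1.
  by rewrite roots_ge0 // => y /sa; move/le_lt_trans; apply.
move=> pas; have ss := path_sorted pas; rewrite ltnS => /IH-/(_ ss)->.
rewrite /roots_ge /= -/(roots_ge s x); case: (leP x a) => //= xa.
rewrite roots_ge0 // => y.
move: pas; rewrite path_sortedE => [/andP[/allP sa _]|]; last first.
  by move=> ? ? ? h1 h2; apply: le_trans h2 h1.
by move/sa/le_lt_trans; apply.
Qed.

Lemma ilc_interlaces f g : ilc f f -> ilc g g -> ilc f g -> interlaces f g.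
Proof.
have rr0 : real_rooted (0 : {poly R}) by exists [::]; split=> //; rewrite lead_coef0 scale0r.
have ge_tot : total (>=%R : rel R) by move=> x y; apply: le_total.
have sorted_ge s := sort_sorted ge_tot s.
have roots_descP h u : nonpos_rooted h u -> roots_desc h (sort >=%R u).
  case=> lh hE _; split=> //; rewrite {1}hE; congr (_ *: _).
  by apply: perm_root_prod; rewrite perm_sym perm_sort.
have rr h : ilc h h -> real_rooted h.
  by case=> [->|[->|[u [_ [hu _ _]]]]] //; exists (sort >=%R u); apply: roots_descP.
move=> /rr ff /rr gg [f0|[g0|[s [t [fs gt st]]]]]; [by left|by right; left|].
right; right; split; [by case: fs|by case: gt|exists (sort >=%R s), (sort >=%R t)].
have {}st : alternate (sort >=%R s) (sort >=%R t).
  by apply: perm_alternate st; rewrite perm_sym perm_sort.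
have sz := alternate_size st; split.
- exact: roots_descP.
- exact: roots_descP.
- case/andP: sz => s1 s2; case: (leqP (size (sort >=%R t)) (size (sort >=%R s))) => h.
    by left; apply/eqP; rewrite eqn_leq h s1.
  by right; apply/eqP; rewrite eqn_leq h s2.
- move=> i il; have := st (sort >=%R s)`_i => /andP[_ /andP[h _]].
  rewrite nth_roots_ge //; last by case/andP: sz => sz _; apply: leq_trans sz.
  by apply: leq_trans h; rewrite -nth_roots_ge.
- move=> i il; have := st (sort >=%R t)`_i.+1 => /andP[_ /andP[_ h]].
  rewrite nth_roots_ge //; last by case/andP: sz => _ sz; rewrite -ltnS (leq_trans il).
  by rewrite -ltnS; apply: leq_trans h; rewrite -nth_roots_ge.
Qed.
End Interlaced.

(** * The passage from one rank to the rank below it *)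

(** The families A, B and C stand for the polynomials of the edges above one
    element, ordered by the index of their labels.  An edge below this element,
    with exactly d labels smaller than its own, has B-part [upper_sum d] and
    C-part [lower_sum d]. *)
Section InterlacingStep.
Variables (R : rcfType) (I : finType) (Q : pred I) (idx : I -> nat).
Variables (A B C : I -> {poly R}).
Hypothesis AE : forall i, Q i -> A i = B i + 'X * C i.
Hypothesis BB : forall i j, Q i -> Q j -> (idx i <= idx j)%N -> ilc (B i) (B j).
Hypothesis AA : forall i j, Q i -> Q j -> (idx i <= idx j)%N -> ilc (A i) (A j).
Hypothesis CB : forall i j, Q i -> Q j -> ilc (C i) (B j).

Let sA (S : pred nat) : {poly R} := \sum_(i | Q i && S (idx i)) A i.
Let sB (S : pred nat) : {poly R} := \sum_(i | Q i && S (idx i)) B i.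

Let sA_split (U S T V : pred nat) : (forall k, S k = U k && T k) ->
  (forall k, V k = U k && ~~ T k) -> sA U = sA S + sA V.
Proof.
move=> SE VE; rewrite /sA (bigID (fun i => T (idx i))) /=.
by congr (_ + _); apply: eq_bigl => i; rewrite ?SE ?VE andbA.
Qed.

Let sB_split (U S T V : pred nat) : (forall k, S k = U k && T k) ->
  (forall k, V k = U k && ~~ T k) -> sB U = sB S + sB V.
Proof.
move=> SE VE; rewrite /sB (bigID (fun i => T (idx i))) /=.
by congr (_ + _); apply: eq_bigl => i; rewrite ?SE ?VE andbA.
Qed.

Let BA i j : Q i -> Q j -> (idx i <= idx j)%N -> ilc (B i) (A j).
Proof.
by move=> Qi Qj ij; rewrite AE //; apply: ilcDr; [apply: BB|apply/ilc_mulX/CB].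
Qed.

Let before (S T : pred nat) := forall k l, S k -> T l -> (k <= l)%N.

Let sAA S T : before S T -> ilc (sA S) (sA T).
Proof.
by move=> ST; apply: ilc_sum => i j /andP[Qi Si] /andP[Qj Tj]; apply: AA => //; apply: ST.
Qed.

Let sBB S T : before S T -> ilc (sB S) (sB T).
Proof.
by move=> ST; apply: ilc_sum => i j /andP[Qi Si] /andP[Qj Tj]; apply: BB => //; apply: ST.
Qed.

Let sBA S T : before S T -> ilc (sB S) (sA T).
Proof.
by move=> ST; apply: ilc_sum => i j /andP[Qi Si] /andP[Qj Tj]; apply: BA => //; apply: ST.
Qed.

Let sA_refl S : ilc (sA S) (sA S).
Proof. by apply: (ilc_sum_refl (idx := idx)) => i j /andP[Qi _] /andP[Qj _]; apply: AA. Qed.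

Let sB_refl S : ilc (sB S) (sB S).
Proof. by apply: (ilc_sum_refl (idx := idx)) => i j /andP[Qi _] /andP[Qj _]; apply: BB. Qed.

(** On one common range of indices, B_i need not interlace A_j for j < i; the
    sums are compared through the C-parts instead. *)
Let sBA_refl S : ilc (sB S) (sA S).
Proof.
have -> : sA S = sB S + 'X * \sum_(i | Q i && S (idx i)) C i.
  by rewrite mulr_sumr -big_split; apply: eq_bigr => i /andP[Qi _]; apply: AE.
apply: ilcDr; first exact: sB_refl.
by apply/ilc_mulX/ilc_sum => i j /andP[Qi _] /andP[Qj _]; apply: CB.
Qed.

Definition upper_sum d : {poly R} := \sum_(i | Q i && (d < idx i)%N) A i.
Definition lower_sum d : {poly R} := \sum_(i | Q i && (idx i <= d)%N) B i.

Let upto d : pred nat := fun k => (k <= d)%N.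
Let within d d' : pred nat := fun k => (d < k <= d')%N.
Let beyond d : pred nat := fun k => (d < k)%N.

Let upper_within d d' : (d <= d')%N -> upper_sum d = sA (within d d') + upper_sum d'.
Proof.
move=> dd'; apply: (@sA_split (beyond d) _ (upto d') (beyond d')) => k;
  by rewrite /within /beyond /upto; move: dd'; clear; lia.
Qed.

Let lower_within d d' : (d <= d')%N -> lower_sum d' = lower_sum d + sB (within d d').
Proof.
move=> dd'; apply: (@sB_split (upto d') (upto d) (upto d)) => k;
  by rewrite /within /upto; move: dd'; clear; lia.
Qed.

Let before_upto d d' d'' : (d <= d')%N -> before (upto d) (within d' d'').
Proof. by move=> dd' k l; rewrite /within /upto; move: dd'; clear; lia. Qed.

Let before_beyond d d' d'' : (d' <= d'')%N -> before (within d d') (beyond d'').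
Proof. by move=> dd' k l; rewrite /within /beyond; move: dd'; clear; lia. Qed.

Let before_upto_beyond d d' : (d <= d')%N -> before (upto d) (beyond d').
Proof. by move=> dd' k l; rewrite /upto /beyond; move: dd'; clear; lia. Qed.

Lemma ilc_upper d d' : (d <= d')%N -> ilc (upper_sum d) (upper_sum d').
Proof.
move=> dd'; rewrite (upper_within dd').
apply: ilcDl; last exact: (sA_refl (beyond d')).
by apply: (@sAA _ (beyond d')); apply: before_beyond.
Qed.

(** When d > d', the indices in between occur on both sides. *)
Lemma ilc_lower_upper d d' : ilc (lower_sum d) (upper_sum d').
Proof.
have [dd'|/ltnW d'd] := leqP d d'.
  by apply: (@sBA (upto d) (beyond d')); apply: before_upto_beyond.
rewrite (lower_within d'd) (upper_within d'd).
apply: ilcDl; apply: ilcDr.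
- by apply: (@sBA (upto d')); apply: before_upto.
- by apply: (@sBA (upto d') (beyond d)); apply: before_upto_beyond.
- exact: sBA_refl.
- by apply: (@sBA _ (beyond d)); apply: before_beyond.
Qed.

(** With the names of the proof and y for the variable, put U = X' + y Z.  The
    claim is that Y + U interlaces U + y W, and it holds because each of Y, U,
    y W interlaces the later ones and U interlaces itself. *)
Lemma ilc_upper_lower d d' : (d <= d')%N ->
  ilc (upper_sum d + 'X * lower_sum d) (upper_sum d' + 'X * lower_sum d').
Proof.
move=> dd'; set X' := upper_sum d'; set Y := sA (within d d').
set Z := lower_sum d; set W := sB (within d d').
have YX : ilc Y X' by apply: (@sAA _ (beyond d')); apply: before_beyond.
have ZY : ilc Z Y by apply: (@sBA (upto d)); apply: before_upto.
have WX : ilc W X' by apply: (@sBA _ (beyond d')); apply: before_beyond.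
have ZW : ilc Z W by apply: (@sBB (upto d)); apply: before_upto.
have ZX : ilc Z X' := ilc_lower_upper d d'.
have WY : ilc W Y := sBA_refl (within d d').
have XX : ilc X' X' := sA_refl (beyond d').
have ZZ : ilc Z Z := sB_refl (upto d).
rewrite (upper_within dd') (lower_within dd') -/X' -/Y -/Z -/W.
rewrite -(addrA Y) mulrDr (addrA X'); set U := X' + 'X * Z.
have UU : ilc U U by apply: ilc_reflD => //; [apply/ilc_mulX/ilc_mulX|apply: ilc_mulX].
have YU : ilc Y U by apply: ilcDr => //; apply: ilc_mulX.
have UW : ilc U ('X * W).
  apply: ilcDl; first exact: ilc_mulX.
  exact: ilc_mulX (ilc_mulX ZW).
by apply: ilcDl; apply: ilcDr => //; apply: ilc_mulX.
Qed.

Let allE (F : I -> {poly R}) : \sum_(i | Q i) F i = \sum_(i | Q i && xpredT (idx i)) F i.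
Proof. by apply: eq_bigl => i; rewrite andbT. Qed.

Lemma ilc_total_refl : ilc (\sum_(i | Q i) A i) (\sum_(i | Q i) A i) /\
  ilc (\sum_(i | Q i) B i) (\sum_(i | Q i) B i).
Proof. by rewrite !allE; split; [apply: (sA_refl xpredT)|apply: (sB_refl xpredT)]. Qed.

Lemma ilc_total_BA : ilc (\sum_(i | Q i) B i) (\sum_(i | Q i) A i).
Proof. by rewrite !allE; apply: (sBA_refl xpredT). Qed.

Let total_split d : \sum_(i | Q i) A i = sA (upto d) + upper_sum d.
Proof.
rewrite allE; apply: (@sA_split xpredT _ (upto d) (beyond d)) => k //.
by rewrite /beyond /upto ltnNge.
Qed.

Lemma ilc_total_upper d : ilc (\sum_(i | Q i) A i) (upper_sum d).
Proof.
rewrite (total_split d).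
apply: ilcDl; last exact: (sA_refl (beyond d)).
by apply: (@sAA (upto d) (beyond d)); apply: before_upto_beyond.
Qed.

Lemma ilc_total_upper_lower d :
  ilc (\sum_(i | Q i) A i) (upper_sum d + 'X * lower_sum d).
Proof.
apply: ilcDr; first exact: ilc_total_upper.
apply: ilc_mulX; rewrite (total_split d).
apply: ilcDr; last exact: ilc_lower_upper.
exact: (sBA_refl (upto d)).
Qed.

Lemma ilc_totalB_upper d : ilc (\sum_(i | Q i) B i) (upper_sum d).
Proof.
rewrite allE (_ : \sum_(i | _) _ = lower_sum d + sB (beyond d)); last first.
  by apply: (@sB_split xpredT (upto d) (upto d)) => k //; rewrite /beyond /upto ltnNge.
apply: ilcDl; first exact: ilc_lower_upper.
exact: (sBA_refl (beyond d)).
Qed.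
End InterlacingStep.

(** * Gamma-expansions *)

Section GammaExpansion.
Variable R : fieldType.
Implicit Types f g : {poly R}.

Lemma gamma_expansionD d f g :
  gamma_expansion d (f + g) = gamma_expansion d f + gamma_expansion d g.
Proof. by rewrite -big_split; apply: eq_bigr => i _; rewrite coefD scalerDl. Qed.

Lemma gamma_expansion0 d : gamma_expansion d 0 = 0 :> {poly R}.
Proof. by apply: big1 => i _; rewrite coef0 scale0r. Qed.

Lemma gamma_expansion_sum d (I : finType) (Q : pred I) (F : I -> {poly R}) :
  gamma_expansion d (\sum_(i | Q i) F i) = \sum_(i | Q i) gamma_expansion d (F i).
Proof.
exact: (big_morph (gamma_expansion d) (gamma_expansionD d) (gamma_expansion0 d)).
Qed.

Lemma gamma_expansion01 : gamma_expansion 0 1 = 1 :> {poly R}.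
Proof. by rewrite /gamma_expansion big_ord1 coef1 scale1r !expr0 mulr1. Qed.

Lemma gamma_expansionX d f : gamma_expansion d.+2 ('X * f) = 'X * gamma_expansion d f.
Proof.
rewrite /gamma_expansion big_ord_recl coefXM eqxx scale0r add0r mulr_sumr.
apply: eq_bigr => i _; rewrite coefXM /= -scalerAr mulrA -exprS.
by rewrite /bump /= add1n doubleS !subSS.
Qed.

Lemma gamma_expansion_size d f : (size f <= d./2.+1)%N ->
  gamma_expansion d f = \sum_(i < size f) f`_i *: ('X^i * (1 + 'X) ^+ (d - i.*2)).
Proof.
move=> szf; rewrite (big_ord_widen _ (fun i => f`_i *: ('X^i * (1 + 'X) ^+ (d - i.*2))) szf).
rewrite big_mkcond; apply: eq_bigr => i _; case: ltnP => // szi.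
by rewrite nth_default // scale0r.
Qed.

(** The bound on the size excludes a term that would be present only in the
    expansion with center (d + 1) / 2. *)
Lemma gamma_expansionS d f : (size f <= d./2.+1)%N ->
  gamma_expansion d.+1 f = (1 + 'X) * gamma_expansion d f.
Proof.
move=> szf; rewrite !gamma_expansion_size //; last first.
  by apply: leq_trans szf _; rewrite ltnS half_leq.
rewrite mulr_sumr; apply: eq_bigr => i _; rewrite -scalerAr mulrCA -exprS subSn //.
have : (i <= d./2)%N by rewrite -ltnS; apply: leq_trans szf.
by clear; lia.
Qed.
End GammaExpansion.

(** * Rising chains in EL-labeled posets *)

Section ELPoset.
Context {disp : Order.disp_t} {P : finTBPOrderType disp}.
Variables (rk : P -> nat) (hrk : is_rank rk).
Context {dispL : Order.disp_t} {L : orderType dispL}.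
Variables (lam : P -> P -> L) (hEL : EL_labeling lam).
Implicit Types s t u v w : P.
Local Notation top := (\top%O : P).

Lemma covers_lt s t : covers s t -> (s < t)%O. Proof. by case/andP. Qed.
Lemma rk_covers s t : covers s t -> rk t = (rk s).+1. Proof. by case: hrk => _; apply. Qed.

Lemma rk_last s p : path covers s p -> rk (last s p) = (rk s + size p)%N /\ (s <= last s p)%O.
Proof.
elim: p s => [|t p IH] s /=; first by rewrite addn0 lexx.
case/andP=> st /IH[-> tp]; rewrite (rk_covers st) addSnnS; split=> //.
exact: le_trans (ltW (covers_lt st)) tp.
Qed.

Lemma rk_le s t : (s <= t)%O -> (rk s <= rk t)%N.
Proof.
move=> /hEL[p [/andP[sp /eqP<-] _ _ _]].
by have [-> _] := rk_last sp; rewrite leq_addr.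
Qed.

Lemma rk_lt s t : (s < t)%O -> (rk s < rk t)%N.
Proof.
move=> st; have /hEL[p [/andP[sp /eqP e] _ _ _]] := ltW st.
have := rk_last sp; rewrite e => -[-> _].
case: p sp e => [_ /= e|*]; last by rewrite addnS ltnS leq_addr.
by move: st; rewrite e ltxx.
Qed.

Lemma rk_top_inj s : rk s = rk top -> s = top.
Proof.
move=> e; apply/eqP; apply: contraT => ne.
by have : (s < top)%O; [rewrite lt_neqAle ne lex1|move/rk_lt; rewrite e ltnn].
Qed.

Lemma corank_covers s t : covers s t -> (rk top - rk s)%N = (rk top - rk t).+1.
Proof. by move=> st; have := rk_le (lex1 t); rewrite (rk_covers st); clear; lia. Qed.

(** Induction from the top element downwards. *)
Lemma edge_ind (T : P -> P -> Prop) :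
  (forall s t, covers s t -> (forall u, covers t u -> T t u) -> T s t) ->
  forall s t, covers s t -> T s t.
Proof.
move=> hT s; have [n] := ubnP (rk top - rk s)%N; elim: n s => // n IH s ltn t st.
apply: hT => // u tu; apply: IH => //.
by rewrite ltnS in ltn; apply: leq_trans ltn; rewrite (corank_covers st).
Qed.

Definition rising_chain s t w p :=
  [&& path covers s (t :: p), last t p == w & sorted <=%O (chain_labels lam s (t :: p))].

(** Whether the rising chain from s to w starts with the edge (s, t). *)
Definition rising s t w : bool := `[< exists p, rising_chain s t w p >].

Definition ascents s t u := covers t u && (lam s t <= lam t u)%O.
Definition descents s t u := covers t u && (lam t u < lam s t)%O.

Lemma rising_chain_cons s t w u p :
  covers s t -> rising_chain s t w (u :: p) = ascents s t u && rising_chain t u w p.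
Proof.
move=> st; rewrite /rising_chain /ascents /= st /=.
by case: (covers t u) => //=; case: (lam s t <= lam t u)%O => /=; rewrite ?andbF ?andbT.
Qed.

Lemma rising_unique s t w t' p p' :
  rising_chain s t w p -> rising_chain s t' w p' -> t :: p = t' :: p'.
Proof.
move=> /and3P[c1 l1 i1] /and3P[c2 l2 i2].
have sw : (s <= w)%O by have [_] := rk_last c1; rewrite /= (eqP l1).
have [q [_ _ uq _]] := hEL sw.
by transitivity q; [|symmetry]; apply: uq => //; rewrite /maximal_chain ?c1 ?c2.
Qed.

Lemma rising_lt s t w : rising s t w -> (s < w)%O.
Proof.
move=> /asboolP[p /and3P[/= /andP[/covers_lt st c] /eqP<- _]].
by apply: lt_le_trans st _; case: (rk_last c).
Qed.

(** At most one of the edges leaving t continues the chain, because [t, w] also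
    has a single rising chain. *)
Lemma risingE s t w : covers s t ->
  (rising s t w : nat) = ((t == w) + \sum_(u | ascents s t u) rising t u w)%N.
Proof.
move=> st; have [tw|tw] := eqVneq t w.
  rewrite big1 => [|u _]; last first.
    by apply/eqP; rewrite eqb0; apply/negP => /rising_lt; rewrite tw ltxx.
  rewrite /rising asboolT //; exists [::].
  by rewrite /rising_chain /= st tw eqxx.
case: (boolP (rising s t w)) => [/asboolP[[|u p] stp]|nr].
- by move: stp; rewrite /rising_chain /= (negPf tw) !andbF.
- move: (stp); rewrite rising_chain_cons // => /andP[stu tup].
  rewrite (bigD1 u) //= /rising asboolT; last by exists p.
  rewrite big1 // => v /andP[stv vu]; rewrite asboolF // => -[q tvq].
  by have [] := rising_unique tup tvq => e; rewrite e eqxx in vu.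
rewrite big1 // => u stu; apply/eqP; rewrite eqb0; apply: contra nr.
by move=> /asboolP[p tup]; apply/asboolP; exists (u :: p); rewrite rising_chain_cons ?stu.
Qed.

Lemma sum_rising s w : (\sum_(t | covers s t) rising s t w)%N = (s < w)%O :> nat.
Proof.
case: (boolP (s < w)%O) => sw; last first.
  rewrite big1 // => t _; apply/eqP; rewrite eqb0.
  by apply: contra sw; apply: rising_lt.
have [[|t p] [/andP[c l] i _ _]] := hEL (ltW sw).
  by move: sw; rewrite -(eqP l) /= ltxx.
have stp : rising_chain s t w p by rewrite /rising_chain c l.
rewrite (bigD1 t) /=; last by case/andP: c.
rewrite /rising asboolT; last by exists p.
rewrite big1 // => t' /andP[_ ne]; rewrite asboolF // => -[q stq].
by have [] := rising_unique stp stq => e; rewrite e eqxx in ne.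
Qed.

(** * Chow polynomials in terms of chains without double descents *)

Section Polys.
Variable R : fieldType.
Implicit Types f g : {poly R}.

(** Generating polynomials by number of descents of the maximal chains from s to
    the top that start with the edge (s, t) and have no two consecutive
    descents; the second component keeps those without a descent at t.  For an
    edge (s, t) the number of steps left is the corank of s. *)
Fixpoint stable_gf_rec n s t : {poly R} * {poly R} :=
  if n is n'.+1 then
    let B := (t == top)%:R + \sum_(u | ascents s t u) (stable_gf_rec n' t u).1 in
    (B + 'X * \sum_(u | descents s t u) (stable_gf_rec n' t u).2, B)
  else (0, 0).

Definition stable_gf s t := (stable_gf_rec (rk top - rk s) s t).1.
Definition stable_gf_asc s t := (stable_gf_rec (rk top - rk s) s t).2.
(** The chains with a descent at t, without the factor X for this descent: the
    next step cannot be a descent. *)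
Definition stable_gf_dsc s t := \sum_(u | descents s t u) stable_gf_asc t u.

Lemma stable_gf_ascE s t : covers s t ->
  stable_gf_asc s t = (t == top)%:R + \sum_(u | ascents s t u) stable_gf t u.
Proof. by move=> st; rewrite /stable_gf_asc (corank_covers st). Qed.

Lemma stable_gfE s t : covers s t ->
  stable_gf s t = stable_gf_asc s t + 'X * stable_gf_dsc s t.
Proof. by move=> st; rewrite /stable_gf /stable_gf_dsc /stable_gf_asc (corank_covers st). Qed.

Lemma covers_top u : covers top u = false.
Proof. by apply/negP => /covers_lt; rewrite le_gtF ?lex1. Qed.

Lemma ascents_top s u : ascents s top u = false. Proof. by rewrite /ascents covers_top. Qed.
Lemma descents_top s u : descents s top u = false. Proof. by rewrite /descents covers_top. Qed.

Lemma size_sum_le (I : finType) (Q : pred I) (F : I -> {poly R}) n :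
  (forall i, Q i -> (size (F i) <= n)%N) -> (size (\sum_(i | Q i) F i)%R <= n)%N.
Proof.
by move=> h; apply: leq_trans (size_sum _ _ _) _; apply/bigmax_leqP.
Qed.

Lemma size_stable_gf s t : covers s t ->
  (size (stable_gf s t) <= (rk top - rk s)./2.+1)%N /\
  (size (stable_gf_asc s t) <= (rk top - rk s).-1./2.+1)%N.
Proof.
move: s t; apply: edge_ind => s t st IH.
rewrite (corank_covers st) /=; set m := (rk top - rk t)%N.
have szB : (size (stable_gf_asc s t) <= m./2.+1)%N.
  rewrite stable_gf_ascE //; apply: leq_trans (size_polyD _ _) _.
  rewrite geq_max; apply/andP; split.
    by case: (t == top); rewrite ?size_poly1 ?size_poly0.
  by apply: size_sum_le => u /andP[/IH[]].
split=> //; rewrite stable_gfE //; apply: leq_trans (size_polyD _ _) _.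
rewrite geq_max; apply/andP; split.
  by apply: leq_trans szB _; clear; lia.
have [->|C0] := eqVneq (stable_gf_dsc s t) 0; first by rewrite mulr0 size_poly0.
rewrite mulrC size_mulX //.
have [tt|tt] := eqVneq t top.
  by move: C0; rewrite /stable_gf_dsc tt big_pred0 ?eqxx // => u; rewrite descents_top.
have m0 : (0 < m)%N by rewrite subn_gt0 rk_lt // lt_neqAle tt lex1.
have : (size (stable_gf_dsc s t) <= m.-1./2.+1)%N by apply: size_sum_le => u /andP[/IH[]].
by move: m0; clear; lia.
Qed.

(** Half the degrees are the centers of symmetry of the augmented, respectively
    non-augmented, Chow polynomial of [s, 1]. *)
Definition hom_gf s t := gamma_expansion (rk top - rk s) (stable_gf s t).
Definition hom_gf_asc s t := gamma_expansion (rk top - rk s).-1 (stable_gf_asc s t).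

Lemma hom_gf_ascE s t : covers s t ->
  hom_gf_asc s t = (t == top)%:R + \sum_(u | ascents s t u) hom_gf t u.
Proof.
move=> st; rewrite /hom_gf_asc stable_gf_ascE // gamma_expansionD gamma_expansion_sum.
rewrite (corank_covers st) /=; congr (_ + _).
case: eqP => [->|_]; rewrite ?gamma_expansion0 // subnn.
exact: gamma_expansion01.
Qed.

Lemma hom_gfE s t : covers s t ->
  hom_gf s t = (1 + 'X) * hom_gf_asc s t + 'X * \sum_(u | descents s t u) hom_gf_asc t u.
Proof.
move=> st; have [_ szB] := size_stable_gf st.
rewrite /hom_gf stable_gfE // gamma_expansionD /hom_gf_asc (corank_covers st) in szB *.
rewrite gamma_expansionS //; congr (_ + _).
have [->|tt] := eqVneq t top.
  by rewrite /stable_gf_dsc !big_pred0 ?mulr0 ?gamma_expansion0 // => u; rewrite descents_top.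
have : (0 < rk top - rk t)%N by rewrite subn_gt0 rk_lt // lt_neqAle tt lex1.
case: (rk top - rk t)%N => // m _.
by rewrite gamma_expansionX gamma_expansion_sum.
Qed.

(** The value that the Chow polynomial of [s, 1] is going to have; the last term
    accounts for s = 1, where there is no edge. *)
Definition chow_sum s : {poly R} := \sum_(t | covers s t) hom_gf_asc s t + (s == top)%:R.

Definition excess s t := hom_gf s t - hom_gf_asc s t.

Lemma sum_ascents_descents s t (F : P -> {poly R}) :
  \sum_(u | covers t u) F u = \sum_(u | ascents s t u) F u + \sum_(u | descents s t u) F u.
Proof.
rewrite (bigID (fun u => (lam s t <= lam t u)%O)) /=; congr (_ + _).
by apply: eq_bigl => u; rewrite /descents ltNge.
Qed.

(** Ascents and descents at t together exhaust the edges above t, which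
    eliminates the sum over descents. *)
Lemma excessE s t : covers s t ->
  excess s t = 'X * chow_sum t + 'X * \sum_(u | ascents s t u) excess t u.
Proof.
move=> st; rewrite /excess sumrB /chow_sum (sum_ascents_descents s) hom_gfE //.
rewrite !(hom_gf_ascE st).
ring.
Qed.

(** The resolvent equation f = F + U f is solved by summing F over rising chains. *)
Lemma rising_sum s t (F : P -> {poly R}) : covers s t ->
  \sum_w F w *+ rising s t w = F t + \sum_(u | ascents s t u) \sum_w F w *+ rising t u w.
Proof.
move=> st; under eq_bigr => w _ do rewrite risingE // mulrnDr.
rewrite big_split /= (bigD1 t) //= eqxx mulr1n big1 ?addr0; last first.
  by move=> w; rewrite eq_sym => /negPf->.
by congr (_ + _); rewrite exchange_big /=; apply: eq_bigr => w _; rewrite -sumrMnr.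
Qed.

Lemma excess_rising s t : covers s t ->
  excess s t = \sum_w ('X^(rk w - rk s) * chow_sum w) *+ rising s t w.
Proof.
move: s t; apply: edge_ind => s t st IH.
rewrite rising_sum // excessE // (rk_covers st) subSn // subnn expr1.
congr (_ + _); rewrite mulr_sumr; apply: eq_bigr => u /andP[tu _].
rewrite IH // mulr_sumr; apply: eq_bigr => w _.
case: (boolP (rising t u w)) => [/rising_lt/rk_lt tw|_]; last by rewrite mulr0.
rewrite !mulr1n mulrA -exprS; congr ('X^_ * _).
by move: tw; rewrite (rk_covers st); clear; lia.
Qed.

(** Both sides differ by a function on the edges that is equal to its own sum over
    the next edges with a weakly larger label; such a function vanishes. *)
Lemma excess_telescope s t : covers s t ->
  excess s t - 'X * \sum_w chow_sum w *+ rising s t w =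
  ('X - 1) * (hom_gf_asc s t - (rising s t top)%:R).
Proof.
move: s t; apply: edge_ind => s t st IH.
rewrite rising_sum // risingE // natrD natr_sum hom_gf_ascE // excessE //.
have -> : \sum_(u | ascents s t u) hom_gf t u =
    \sum_(u | ascents s t u) excess t u + \sum_(u | ascents s t u) hom_gf_asc t u.
  by rewrite -big_split; apply: eq_bigr => u _; rewrite /excess /= subrK.
have : \sum_(u | ascents s t u) (excess t u - 'X * \sum_w chow_sum w *+ rising t u w) =
    \sum_(u | ascents s t u) ('X - 1) * (hom_gf_asc t u - (rising t u top)%:R).
  by apply: eq_bigr => u /andP[tu _]; apply: IH.
rewrite sumrB -!mulr_sumr !sumrB => e.
apply/eqP; rewrite -subr_eq0; apply/eqP; move/eqP: e; rewrite -subr_eq0 => /eqP e.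
by rewrite -[RHS]e; ring.
Qed.

Definition aug_chow_sum s : {poly R} := \sum_(w | (s <= w)%O) 'X^(rk w - rk s) * chow_sum w.

(** Each w > s is the end of exactly one rising chain from s, and this chain
    starts with exactly one of the edges above s. *)
Lemma sum_ge_rising s (F : P -> {poly R}) : \sum_(w | (s <= w)%O) F w =
  F s + \sum_(t | covers s t) \sum_w F w *+ rising s t w.
Proof.
rewrite (bigD1 s) //=; congr (_ + _).
rewrite exchange_big /= big_mkcond; apply: eq_bigr => w _.
by rewrite sumrMnr sum_rising lt_def andbC; case: ifP.
Qed.

Lemma aug_chow_sum_excess s : aug_chow_sum s = chow_sum s + \sum_(t | covers s t) excess s t.
Proof.
rewrite /aug_chow_sum sum_ge_rising subnn expr0 mul1r; congr (_ + _).
by apply: eq_bigr => t /excess_rising.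
Qed.

Lemma aug_chow_sumE s : aug_chow_sum s = \sum_(t | covers s t) hom_gf s t + (s == top)%:R.
Proof.
rewrite aug_chow_sum_excess /chow_sum /excess sumrB; ring.
Qed.

(** The defining relation of Chow polynomials in a form without the Moebius
    function. *)
Lemma aug_chow_sum_rel s : aug_chow_sum s = 'X * \sum_(w | (s <= w)%O) chow_sum w - ('X - 1).
Proof.
have := sum_rising s top; rewrite lt_neqAle lex1 andbT => T1.
have {}T1 : \sum_(t | covers s t) (rising s t top)%:R + (s == top)%:R = 1 :> {poly R}.
  by rewrite -natr_sum T1; case: eqP; rewrite ?addr0 ?add0r.
have : \sum_(t | covers s t) (excess s t - 'X * \sum_w chow_sum w *+ rising s t w) =
    \sum_(t | covers s t) ('X - 1) * (hom_gf_asc s t - (rising s t top)%:R).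
  by apply: eq_bigr => t /excess_telescope.
rewrite sumrB -!mulr_sumr !sumrB aug_chow_sum_excess (sum_ge_rising s chow_sum) => e.
have hE : \sum_(t | covers s t) hom_gf_asc s t = chow_sum s - (s == top)%:R.
  by rewrite /chow_sum addrK.
rewrite hE in e.
move/eqP: e; rewrite -subr_eq0 => /eqP e; move/eqP: T1; rewrite -subr_eq0 => /eqP T1.
apply/eqP; rewrite -subr_eq0; apply/eqP.
rewrite -[RHS]addr0 -[X in _ = X + _]e -[X in _ = _ + X](mulr0 (1 - 'X)).
by rewrite -[X in _ = _ + _ * X]T1 /excess !sumrB hE; ring.
Qed.

Lemma sum_mobius s t : (s <= t)%O -> \sum_(w | (s <= w <= t)%O) mobius s w = (s == t)%:R.
Proof.
move=> st; rewrite (bigD1 t) /=; last by rewrite st lexx.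
rewrite [mobius s t]mobiusE; case: eqP => [<-|/eqP ne].
  rewrite big1 ?addr0 // => w /andP[/andP[sw ws] /eqP[]].
  by apply/eqP; rewrite eq_le sw ws.
rewrite lt_neqAle ne st (eq_bigl (fun w => (s <= w < t)%O)) ?addNr // => w.
by rewrite lt_neqAle -andbA; congr (_ && _); rewrite andbC.
Qed.

(** Expanding the characteristic polynomials gives the sum of
    mu(s, v) times [aug_chow_sum v]; the previous relation then leaves only
    sums of the Moebius function over intervals. *)
Lemma sum_char_poly_chow_sum s :
  \sum_(w | (s <= w)%O) char_poly_itv R rk s w * chow_sum w =
  'X * chow_sum s - ('X - 1) * (s == top)%:R.
Proof.
transitivity (\sum_(v | (s <= v)%O) (mobius s v)%:~R *: aug_chow_sum v).
  under eq_bigr => w _ do rewrite mulr_suml.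
  rewrite (exchange_big_dep (fun v => s <= v)%O) /=; last by move=> w v _ /andP[].
  apply: eq_bigr => v sv; rewrite scaler_sumr; apply: eq_big => [w|w _].
    by rewrite sv andTb andb_idl //; apply: le_trans.
  by rewrite scalerAl.
have sumE (F : P -> {poly R}) :
    \sum_(v | (s <= v)%O) \sum_(w | (v <= w)%O) (mobius s v)%:~R *: F w = F s.
  rewrite (exchange_big_dep (fun w => s <= w)%O) /=; last by move=> v w; apply: le_trans.
  have e w : (s <= w)%O ->
      \sum_(v | (s <= v)%O && (v <= w)%O) (mobius s v)%:~R *: F w = (s == w)%:R *: F w.
    by move=> sw; rewrite -scaler_suml -rmorph_sum /= sum_mobius //; case: (s == w).
  rewrite (eq_bigr _ e) (bigD1 s) //= eqxx scale1r big1 ?addr0 // => w /andP[_].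
  by rewrite eq_sym => /negPf->; rewrite scale0r.
under eq_bigr => v _ do rewrite aug_chow_sum_rel scalerBr mulr_sumr scaler_sumr.
rewrite sumrB sumE; congr (_ - _).
rewrite -scaler_suml -rmorph_sum /= (eq_bigl (fun v => (s <= v <= top)%O)); last first.
  by move=> v; rewrite lex1 andbT.
by rewrite sum_mobius ?lex1 //; case: eqP; rewrite ?scale1r ?scale0r ?mulr1 ?mulr0.
Qed.

(** The values of the Moebius function on [s, t] add up to 0, so 1 is a root. *)
Lemma red_char_polyE s t : (s < t)%O ->
  ('X - 1) * red_char_poly R rk s t = char_poly_itv R rk s t.
Proof.
move=> st; rewrite mulrC /red_char_poly divpK // -[1]/(1%:P) dvdp_XsubCl rootE.
rewrite horner_sum; under eq_bigr => w _ do rewrite hornerZ hornerXn expr1n mulr1.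
by rewrite -rmorph_sum /= sum_mobius ?ltW // lt_eqF.
Qed.

Lemma char_poly_itvxx s : char_poly_itv R rk s s = 1.
Proof.
rewrite /char_poly_itv (bigD1 s) /=; last by rewrite lexx.
rewrite mobiusE eqxx subnn expr0 scale1r big1 ?addr0 // => w /andP[/andP[sw ws] /eqP[]].
by apply/eqP; rewrite eq_le sw ws.
Qed.

(** Both sides satisfy the same recursion, multiplied by X - 1. *)
Lemma chowE_sum s : chow R rk s top = chow_sum s.
Proof.
have [n] := ubnP (rk top - rk s)%N; elim: n s => // n IH s /ltnSE sn.
rewrite chowE; case: eqP => [->|/eqP st].
  by rewrite /chow_sum big_pred0 ?eqxx ?add0r // => u; rewrite covers_top.
have X1 : 'X - 1 != 0 :> {poly R} by rewrite -[1]/(1%:P) polyXsubC_eq0.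
apply: (mulfI X1).
rewrite mulr_sumr (eq_bigl (fun w => (s <= w)%O && (w != s))); last first.
  by move=> w; rewrite lex1 andbT lt_def andbC.
have slt : (s < top)%O by rewrite lt_neqAle st lex1.
rewrite (eq_bigr (fun w => char_poly_itv R rk s w * chow_sum w)); last first.
  move=> w /andP[sw ws].
  have {ws} sw' : (s < w)%O by rewrite lt_def ws.
  rewrite mulrA red_char_polyE // IH //; apply: leq_trans sn.
  by move: (rk_lt sw') (rk_lt slt); clear; lia.
have := sum_char_poly_chow_sum s.
rewrite (bigD1 s) //= char_poly_itvxx mul1r (negPf st) mulr0 subr0.
by move=> e; rewrite mulrBl -e mul1r addrAC subrr add0r.
Qed.

Lemma aug_chowE_sum s : aug_chow R rk s top = aug_chow_sum s.
Proof.
rewrite /aug_chow; apply: eq_big => [w|w _]; first by rewrite lex1 andbT.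
by rewrite chowE_sum.
Qed.

Lemma gamma_chowE s :
  gamma_chow R rk s top = \sum_(t | covers s t) stable_gf_asc s t + (s == top)%:R.
Proof.
apply: gamma_polyE; split.
  apply: leq_trans (size_polyD _ _) _; rewrite geq_max; apply/andP; split.
    by apply: size_sum_le => t /size_stable_gf[].
  by case: (s == top); rewrite ?size_poly1 ?size_poly0.
rewrite chowE_sum /chow_sum gamma_expansionD gamma_expansion_sum; congr (_ + _).
by case: eqP => [->|_]; rewrite ?gamma_expansion0 // subnn gamma_expansion01.
Qed.

Lemma gamma_aug_chowE s :
  gamma_aug_chow R rk s top = \sum_(t | covers s t) stable_gf s t + (s == top)%:R.
Proof.
apply: gamma_polyE; split.
  apply: leq_trans (size_polyD _ _) _; rewrite geq_max; apply/andP; split.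
    by apply: size_sum_le => t /size_stable_gf[].
  by case: (s == top); rewrite ?size_poly1 ?size_poly0.
rewrite aug_chowE_sum aug_chow_sumE gamma_expansionD gamma_expansion_sum; congr (_ + _).
by case: eqP => [->|_]; rewrite ?gamma_expansion0 // subnn gamma_expansion01.
Qed.
End Polys.
End ELPoset.

(** * Rank-uniform labelings *)

Lemma index_count_lt (disp : Order.disp_t) (L : orderType disp) (r : seq L) (y l : L) :
  sorted <%O r -> y \in r -> (index y r < count (fun x => (x < l)%O) r)%N = (y < l)%O.
Proof.
elim: r => // a r IH; rewrite [sorted _ _]/= (path_sortedE lt_trans) => /andP[allr sr].
have ar := allP allr.
have big z : (l <= z)%O -> all (fun x => (z < x)%O) r -> count (fun x => (x < l)%O) r = 0%N.
  move=> lz /allP zr; apply/eqP; rewrite -leqn0 leqNgt -has_count; apply/hasPn => x /zr zx.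
  by rewrite -leNgt; apply: le_trans lz (ltW zx).
rewrite inE /=; case: eqVneq => [-> _|ya /= yr].
  by case: (ltP a l) => al //=; rewrite (big a).
case: (ltP a l) => al; first by rewrite add1n ltnS IH.
rewrite (big a) //.
by apply/esym/negbTE; rewrite -leNgt; apply: le_trans al (ltW (ar _ yr)).
Qed.

Section RankUniform.
Context {disp : Order.disp_t} {P : finTBPOrderType disp}.
Variables (rk : P -> nat) (hrk : is_rank rk).
Context {dispL : Order.disp_t} {L : orderType dispL}.
Variables (lam : P -> P -> L) (hEL : EL_labeling lam).
Hypotheses (hunif : rank_uniform lam rk) (hmono : monotonic lam rk).
Variable R : rcfType.
Implicit Types s t u v w : P.
Local Notation top := (\top%O : P).
Local Notation Ind := (Ind lam).
Local Notation des := (des lam).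
Local Notation A := (stable_gf rk lam R).
Local Notation B := (stable_gf_asc rk lam R).
Local Notation C := (stable_gf_dsc rk lam R).

Lemma mem_labels_above t u : covers t u -> lam t u \in labels_above lam t.
Proof.
move=> tu; rewrite mem_sort mem_undup; apply: map_f.
by rewrite mem_filter tu mem_enum.
Qed.

Lemma Ind_le t u : covers t u -> (0 < Ind t u <= nlabels lam t)%N.
Proof. by move=> /mem_labels_above tu; rewrite /= index_mem. Qed.

(** Descents are decided by the index of the next label alone, which is the
    information that rank-uniformity preserves. *)
Lemma descent_Ind s t u : covers t u -> (lam t u < lam s t)%O = (Ind t u <= des s t)%N.
Proof.
move=> /mem_labels_above tu; rewrite /des size_filter index_count_lt //.
by rewrite lt_sorted_uniq_le sort_uniq undup_uniq sort_le_sorted.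
Qed.

Lemma descents_Ind s t u : descents lam s t u = covers t u && (Ind t u <= des s t)%N.
Proof. by rewrite /descents; case: (boolP (covers t u)) => //= /descent_Ind->. Qed.

Lemma ascents_Ind s t u : ascents lam s t u = covers t u && (des s t < Ind t u)%N.
Proof.
by rewrite /ascents; case: (boolP (covers t u)) => //= tu; rewrite leNgt descent_Ind // ltnNge.
Qed.

(** Group the edges by index: the widths say that each group has the same size
    above t and above t'. *)
Lemma sum_Ind t t' (S : pred nat) (F F' : P -> {poly R}) : rk t = rk t' ->
    (forall u u', covers t u -> covers t' u' -> Ind t u = Ind t' u' -> F u = F' u') ->
  \sum_(u | covers t u && S (Ind t u)) F u = \sum_(u | covers t' u && S (Ind t' u)) F' u.
Proof.
move=> tt' FF'; pose N := maxn (nlabels lam t) (nlabels lam t').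
have part v (G : P -> {poly R}) : (nlabels lam v <= N)%N ->
    \sum_(u | covers v u && S (Ind v u)) G u =
    \sum_(i < N.+1 | S i) \sum_(u | covers v u && (Ind v u == i)) G u.
  move=> vN; rewrite (exchange_big_dep (fun u => covers v u && S (Ind v u))) /=.
    apply: eq_bigr => u /andP[vu Su].
    have uN : (Ind v u < N.+1)%N.
      by have /andP[_ h] := Ind_le vu; rewrite ltnS (leq_trans h).
    rewrite (big_pred1 (Ordinal uN)) // => i; rewrite /= vu /= -val_eqE /= eq_sym.
    by case: eqP => [->|]; rewrite ?Su ?andbF.
  by move=> i u Si /andP[-> /eqP->].
rewrite !part ?leq_maxl ?leq_maxr //; apply: eq_bigr => i _.
have [i0|i0] := posnP i.
  by rewrite !big_pred0 // => u; rewrite i0 andbF.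
have /(_ t t' i tt' i0) := hunif.1; rewrite /width !cardsE => W.
case: (pickP (fun u => covers t' u && (Ind t' u == i))) => [u0 /andP[tu0 /eqP u0i]|none].
  rewrite (eq_bigr (fun _ => F' u0)) => [|u /andP[tu /eqP ui]]; last first.
    by apply: FF' => //; rewrite ui.
  rewrite [RHS](eq_bigr (fun _ => F' u0)) => [|u /andP[tu /eqP ui]]; last first.
    by have [v /andP[tv /eqP vi]|none] :=
         pickP (fun v => covers t v && (Ind t v == i));
       [rewrite -(FF' v u) ?vi // (FF' v u0) ?vi|
        move: W; rewrite (eq_card0 none) => /esym/card0_eq/(_ u);
        rewrite unfold_in /= tu ui eqxx].
  by rewrite !sumr_const W.
move: W; rewrite [RHS](eq_card0 none) => /card0_eq none'.
by rewrite !big_pred0.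
Qed.

Lemma stable_gf_uniform s t s' t' : covers s t -> covers s' t' -> rk s = rk s' ->
  Ind s t = Ind s' t' -> A s t = A s' t' /\ B s t = B s' t'.
Proof.
move=> st; move: s t st s' t'; apply: (edge_ind hrk hEL) => s t st IH s' t' st' ss' ii'.
have dd : des s t = des s' t' by apply: hunif.2.
have tt' : rk t = rk t' by rewrite (rk_covers hrk st) ss' (rk_covers hrk st').
have topE : (t == top) = (t' == top).
  by apply/eqP/eqP => e; apply: (rk_top_inj hrk hEL); rewrite -e.
have BE : B s t = B s' t'.
  rewrite !(stable_gf_ascE hrk hEL) // topE; congr (_ + _).
  rewrite (eq_bigl _ _ (ascents_Ind s t)) (eq_bigl _ _ (ascents_Ind s' t')) dd.
  apply: (@sum_Ind _ _ (ltn (des s' t'))) => // u u' tu tu' uu'.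
  by have [] := IH u tu t' u' tu' tt' uu'.
split=> //; rewrite !(stable_gfE hrk hEL) // BE; congr (_ + 'X * _); rewrite /stable_gf_dsc.
rewrite (eq_bigl _ _ (descents_Ind s t)) (eq_bigl _ _ (descents_Ind s' t')) dd.
apply: (@sum_Ind _ _ (fun k => k <= des s' t')%N) => // u u' tu tu' uu'.
by have [] := IH u tu t' u' tu' tt' uu'.
Qed.

(** The hypothesis of monotonicity compares values at chosen edges of a given
    rank and index; uniformity carries it over to all of them. *)
Lemma des_monotone s t s' t' : covers s t -> covers s' t' -> rk s = rk s' ->
  (Ind s t <= Ind s' t')%N -> (des s t <= des s' t')%N.
Proof.
move=> st st' ss' ii'.
have desE v w : covers v w -> rk v = rk s -> des_k lam rk (rk s) (Ind v w) = des v w.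
  move=> vw vs; rewrite /des_k; case: pickP => [[x y] /= /and3P[xy /eqP xs /eqP e]|].
    by apply: hunif.2; rewrite // vs.
  by move=> /(_ (v, w)); rewrite /= vw vs !eqxx.
rewrite -desE // -(desE s') //; apply: hmono => //.
  by have := corank_covers hrk hEL st; clear; lia.
rewrite /nlabels_k; case: pickP => [v /eqP vs|/(_ s)]; last by rewrite eqxx.
have : (0 < width lam v (Ind s' t'))%N.
  by rewrite (hunif.1 v s') ?vs // card_gt0; apply/set0Pn; exists t'; rewrite inE st' eqxx.
rewrite card_gt0 => /set0Pn[u]; rewrite inE => /andP[vu /eqP <-].
by case/andP: (Ind_le vu).
Qed.

(** The sum may be taken over the edges above any element of the rank of t.
    This lets edges ending at different elements be compared. *)
Lemma stable_gf_asc_upper s t v : covers s t -> t != top -> rk v = rk t ->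
  B s t = upper_sum (covers v) (Ind v) (A v) (des s t).
Proof.
move=> st tt vt; rewrite (stable_gf_ascE hrk hEL) // (negPf tt) add0r.
rewrite (eq_bigl _ _ (ascents_Ind s t)).
apply: (@sum_Ind _ _ (ltn (des s t))) => // u u' tu tu' uu'.
by have [] := stable_gf_uniform tu tu' (esym vt) uu'.
Qed.

Lemma stable_gf_dsc_lower s t v : covers s t -> rk v = rk t ->
  C s t = lower_sum (covers v) (Ind v) (B v) (des s t).
Proof.
move=> st vt; rewrite /stable_gf_dsc (eq_bigl _ _ (descents_Ind s t)).
apply: (@sum_Ind _ _ (fun k => k <= des s t)%N) => // u u' tu tu' uu'.
by have [] := stable_gf_uniform tu tu' (esym vt) uu'.
Qed.

Lemma stable_gf_asc_top s : covers s top -> B s top = 1.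
Proof.
move=> st; rewrite (stable_gf_ascE hrk hEL) // eqxx big_pred0 ?addr0 // => u.
exact: ascents_top.
Qed.

Lemma stable_gf_dsc_top s : C s top = 0.
Proof. by rewrite /stable_gf_dsc big_pred0 // => u; rewrite descents_top. Qed.

(** The induction hypothesis, applied to pairs of edges above t, provides the
    three hypotheses of the passage from one rank to the rank below it.  At
    corank 1 all chains are single edges. *)
Lemma edges_interlace s t : covers s t -> forall s' t', covers s' t' -> rk s = rk s' ->
  [/\ (Ind s t <= Ind s' t')%N -> ilc (B s t) (B s' t'),
      (Ind s t <= Ind s' t')%N -> ilc (A s t) (A s' t') & ilc (C s t) (B s' t')].
Proof.
move: s t; apply: (edge_ind hrk hEL) => s t st IH s' t' st' ss'.
have tt' : rk t' = rk t by rewrite (rk_covers hrk st) ss' (rk_covers hrk st').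
rewrite !(stable_gfE hrk hEL) //; case: (eqVneq t top) => [te|tn].
  have te' : t' = top by apply: (rk_top_inj hrk hEL); rewrite tt' te.
  rewrite te te' in st st' *; rewrite !stable_gf_dsc_top !stable_gf_asc_top // mulr0 addr0.
  by split=> [_|_|]; [apply: ilc11|apply: ilc11|apply: ilc0f].
have tn' : t' != top.
  by apply: contra_neq tn => e; apply: (rk_top_inj hrk hEL); rewrite -tt' e.
have AE i : covers t i -> A t i = B t i + 'X * C t i by apply: stable_gfE.
have BB i j : covers t i -> covers t j -> (Ind t i <= Ind t j)%N -> ilc (B t i) (B t j).
  by move=> ti tj; have [] := IH i ti t j tj erefl.
have AA i j : covers t i -> covers t j -> (Ind t i <= Ind t j)%N -> ilc (A t i) (A t j).
  by move=> ti tj; have [] := IH i ti t j tj erefl.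
have CB i j : covers t i -> covers t j -> ilc (C t i) (B t j).
  by move=> ti tj; have [] := IH i ti t j tj erefl.
rewrite (stable_gf_asc_upper st tn (erefl (rk t))) (stable_gf_asc_upper st' tn' (esym tt')).
rewrite (stable_gf_dsc_lower st (erefl (rk t))) (stable_gf_dsc_lower st' (esym tt')).
split=> [/(des_monotone st st' ss') dd|/(des_monotone st st' ss') dd|].
- by apply: ilc_upper.
- by apply: (ilc_upper_lower AE).
- by apply: (ilc_lower_upper AE).
Qed.

Lemma edges_above_ilc s :
  [/\ forall i, covers s i -> A s i = B s i + 'X * C s i,
      {in covers s &, forall i j, (Ind s i <= Ind s j)%N -> ilc (B s i) (B s j)},
      {in covers s &, forall i j, (Ind s i <= Ind s j)%N -> ilc (A s i) (A s j)}
    & {in covers s &, forall i j, ilc (C s i) (B s j)}].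
Proof.
by split=> [i|i j si sj|i j si sj|i j si sj]; [exact: stable_gfE|..];
  have [] := edges_interlace si sj erefl.
Qed.

Lemma ilc_chow_refl s : ilc (gamma_chow R rk s top) (gamma_chow R rk s top).
Proof.
rewrite (gamma_chowE hrk hEL); have [->|st] := eqVneq s top.
  by rewrite big_pred0 ?add0r; [apply: ilc11|apply: covers_top].
have [AE BB AA CB] := edges_above_ilc s; rewrite addr0.
by have [] := ilc_total_refl AA BB.
Qed.

Lemma ilc_aug_chow_refl s : ilc (gamma_aug_chow R rk s top) (gamma_aug_chow R rk s top).
Proof.
rewrite (gamma_aug_chowE hrk hEL); have [->|st] := eqVneq s top.
  by rewrite big_pred0 ?add0r; [apply: ilc11|apply: covers_top].
have [AE BB AA CB] := edges_above_ilc s; rewrite addr0.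
by have [] := ilc_total_refl AA BB.
Qed.

Lemma ilc_chow_aug s : ilc (gamma_chow R rk s top) (gamma_aug_chow R rk s top).
Proof.
rewrite (gamma_chowE hrk hEL) (gamma_aug_chowE hrk hEL); have [->|st] := eqVneq s top.
  by rewrite !big_pred0 ?add0r; [apply: ilc11|apply: covers_top..].
have [AE BB AA CB] := edges_above_ilc s; rewrite !addr0.
exact: ilc_total_BA AE BB CB.
Qed.

(** The polynomials of s are sums over its covers t.  Each summand is built from
    the edges above t, hence from the edges above a, since t and a have the same
    rank; so it can be compared with the full sums over the edges above a. *)
Lemma ilc_cover_chow s a : covers s a ->
  [/\ ilc (gamma_aug_chow R rk a top) (gamma_chow R rk s top),
      ilc (gamma_aug_chow R rk a top) (gamma_aug_chow R rk s top)
    & ilc (gamma_chow R rk a top) (gamma_chow R rk s top)].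
Proof.
move=> sa; have sn : s != top by apply: contraTneq sa => ->; rewrite covers_top.
rewrite !(gamma_chowE hrk hEL) !(gamma_aug_chowE hrk hEL) (negPf sn) !addr0.
have rka t : covers s t -> rk a = rk t by rewrite (rk_covers hrk sa) => /(rk_covers hrk)->.
have [ae|an] := eqVneq a top.
  have nocover : covers top =1 xpred0 := @covers_top _ P.
  rewrite ae !(big_pred0 _ _ _ _ nocover) !add0r.
  have tE t : covers s t -> t = top.
    by move=> st; apply: (rk_top_inj hrk hEL); rewrite -(rka t st) ae.
  split; apply: ilc_sumr => t st; rewrite ?(stable_gfE hrk hEL) //;
    move: (st); rewrite (tE t st) => st';
    rewrite ?stable_gf_dsc_top ?mulr0 ?addr0 stable_gf_asc_top //; apply: ilc11.
have [AE BB AA CB] := edges_above_ilc a; rewrite !addr0.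
have tn t : covers s t -> t != top.
  move=> st; apply: contra_neq an => te; apply: (rk_top_inj hrk hEL).
  by rewrite (rka t st) te.
split; apply: ilc_sumr => t st; rewrite ?(stable_gfE hrk hEL) //;
  rewrite ?(stable_gf_dsc_lower st (rka t st)) //;
  rewrite (stable_gf_asc_upper st (tn t st) (rka t st)).
- by apply: ilc_total_upper.
- by apply: (ilc_total_upper_lower AE).
- by apply: (ilc_totalB_upper AE).
Qed.
End RankUniform.

Theorem theorem5p4 (R : rcfType)
  (disp : Order.disp_t) (P : finTBPOrderType disp)
  (rk : P -> nat) (hrk : is_rank rk)
  (dispL : Order.disp_t) (L : orderType dispL) (lam : P -> P -> L)
  (hEL : EL_labeling lam) (hunif : rank_uniform lam rk)
  (hmono : monotonic lam rk)
  (a : P) (ha : rk a = 1%N) :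
  [/\ interlaces (gamma_chow R rk \bot%O \top%O) (gamma_aug_chow R rk \bot%O \top%O),
      interlaces (gamma_aug_chow R rk a \top%O) (gamma_chow R rk \bot%O \top%O),
      interlaces (gamma_aug_chow R rk a \top%O) (gamma_aug_chow R rk \bot%O \top%O)
    & des_k lam rk 0 (nlabels lam \bot%O) = nlabels lam a ->
      interlaces (gamma_chow R rk a \top%O) (gamma_chow R rk \bot%O \top%O)].
Proof.
have bot_a : covers \bot%O a.
  apply/andP; split.
    by rewrite lt_neqAle le0x andbT; apply/eqP => e; move: ha; rewrite -e hrk.1.
  apply/forallP => w; apply/negP => /andP[/(rk_lt hrk hEL) w0 /(rk_lt hrk hEL)].
  by rewrite ha ltnS leqn0; move: w0; rewrite hrk.1; case: (rk w).
have chow_refl s := ilc_chow_refl hrk hEL hunif hmono R s.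
have aug_refl s := ilc_aug_chow_refl hrk hEL hunif hmono R s.
have [c1 c2 c3] := ilc_cover_chow hrk hEL hunif hmono R bot_a.
split=> [|||_]; apply: ilc_interlaces => //.
exact: (ilc_chow_aug hrk hEL hunif hmono).
Qed.
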